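(* Let $\mathcal C\subseteq \mathbb{P}^1\times\mathbb{P}^1\times\mathbb{P}^1$ be a complete intersection of points of type $(a,b,c)$, and let $X_{\mathcal C}$ be the grid of lines arising from $\mathcal C$. Then $X_{\mathcal C}$ is arithmetically Cohen–Macaulay and a trigraded minimal free resolution of $I_{X_{\mathcal C}}$ is $$0 \rightarrow R^2(-a,-b,-c) \rightarrow R(-a,-b,0) \oplus R(-a,0,-c) \oplus R(0,-b,-c) \rightarrow I_{X_{\mathcal C}} \rightarrow 0.$$
   Context: $R=K[x_{1,0},x_{1,1},x_{2,0},x_{2,1},x_{3,0},x_{3,1}]$ ($K$ algebraically closed, characteristic zero) trigraded by $\deg x_{i,j}=\mathbf e_i$, coordinate ring of $\mathbb{P}^1\times\mathbb{P}^1\times\mathbb{P}^1$. A finite set of points $\mathcal C$ is a complete intersection of points of type $(a_1,a_2,a_3)$ if its (trihomogeneous) defining ideal is $I_{\mathcal C}=(F_1,F_2,F_3)$ with $F_1,F_2,F_3$ a regular sequence and $\deg F_i=a_i\mathbf e_i$. A line is the zero locus $\mathcal L(F,G)$ of $(F,G)$ with $F,G$ linear forms of two different degrees among $\mathbf e_1,\mathbf e_2,\mathbf e_3$; through each point $P$ pass exactly three lines, one of each type. The grid of lines $X_{\mathcal C}$ is the union of all lines of $\mathbb{P}^1\times\mathbb{P}^1\times\mathbb{P}^1$ passing through some point of $\mathcal C$; $I_{X_{\mathcal C}}$ is the intersection of the ideals of these lines, and $X_{\mathcal C}$ is arithmetically Cohen–Macaulay if $R/I_{X_{\mathcal C}}$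 is Cohen–Macaulay. $R(-\mathbf d)$ denotes $R$ with shifted trigrading. *)

(* Defs.v *)
From HB Require Import structures.
From mathcomp Require Import all_boot all_order all_algebra.
From mathcomp Require Import mpoly.
Set Implicit Arguments. Unset Strict Implicit. Unset Printing Implicit Defensive.
Import GRing.Theory.
Local Open Scope ring_scope.

Section GridDefs.
Variable K : fieldType.

(* R = K[x_{1,0},x_{1,1},x_{2,0},x_{2,1},x_{3,0},x_{3,1}]; the variable x_{i,j}
   (i = 1,2,3 written as 0,1,2 ; j = 0,1) is 'X_(2*i + j). *)
Local Notation R := {mpoly K[6]}.

Definition xvar (i : 'I_3) (j : 'I_2) : R := 'X_(inord (2 * i + j)).

Definition tdeg (m : 'X_{1..6}) : nat * nat * nat :=
  (m (inord 0) + m (inord 1), m (inord 2) + m (inord 3), m (inord 4) + m (inord 5))%N.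

(* F is trihomogeneous of tridegree d (the zero polynomial is trihomogeneous
   of every degree) *)
Definition trihom (d : nat * nat * nat) (F : R) : Prop :=
  forall m, m \in msupp F -> tdeg m = d.

Definition tcomp (d : nat * nat * nat) (F : R) : R :=
  \sum_(m <- msupp F | tdeg m == d) F@_m *: 'X_[m].

Definition in_irrel (F : R) : Prop := F@_0%MM = 0.

Definition span_with (J : R -> Prop) (gs : seq R) (f : R) : Prop :=
  exists g (cs : seq R), J g /\ f = g + \sum_(k < size gs) cs`_k * gs`_k.

Definition zero_ideal (f : R) : Prop := f = 0.

Definition gen (gs : seq R) : R -> Prop := span_with zero_ideal gs.

Definition is_ideal (J : R -> Prop) : Prop :=
  [/\ J 0, (forall f g, J f -> J g -> J (f + g)) & (forall r f, J f -> J (r * f))].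

Definition is_prime (J : R -> Prop) : Prop :=
  [/\ is_ideal J, ~ J 1 & forall f g, J (f * g) -> J f \/ J g].

Definition nzd_mod (J : R -> Prop) (g : R) : Prop :=
  forall f, J (f * g) -> J f.

Definition regseq_mod (J : R -> Prop) (gs : seq R) : Prop :=
  ~ span_with J gs 1 /\
  forall k, (k < size gs)%N -> nzd_mod (span_with J (take k gs)) gs`_k.

Definition prime_chain (J : R -> Prop) (n : nat) : Prop :=
  exists P : nat -> R -> Prop,
    (forall k, (k <= n)%N -> is_prime (P k) /\ forall f, J f -> P k f) /\
    (forall k, (k < n)%N ->
       (forall f, P k f -> P k.+1 f) /\ exists f, P k.+1 f /\ ~ P k f).

Definition krull_dim_quot (J : R -> Prop) (n : nat) : Prop :=
  prime_chain J n /\ ~ prime_chain J n.+1.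

(* R/J (J trihomogeneous) is Cohen-Macaulay: the depth of R/J with respect to
   the homogeneous maximal ideal equals dim R/J, i.e. there is an R/J-regular
   sequence in (x_{i,j}) of length dim R/J (depth <= dim always holds). *)
Definition CM_quot (J : R -> Prop) : Prop :=
  exists n, krull_dim_quot J n /\
    exists gs : seq R, size gs = n /\ (forall g, g \in gs -> in_irrel g) /\
      regseq_mod J gs.

(* a point is given by homogeneous coordinates ([u_1:v_1],[u_2:v_2],[u_3:v_3]) *)
Definition point := {ffun 'I_3 -> K * K}.

Definition pt_ok (P : point) : Prop := forall i, P i != (0, 0).

Definition pt_vec (P : point) : 'I_6 -> K :=
  fun k => let p := P (inord (k %/ 2)) in if odd k then p.2 else p.1.

(* I_C: the ideal generated by the trihomogeneous forms vanishing on C, i.e.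
   the polynomials all of whose trihomogeneous components vanish on C *)
Definition I_pts (C : seq point) (F : R) : Prop :=
  forall d P, P \in C -> (tcomp d F).@[pt_vec P] = 0.

Definition is_CI_type (C : seq point) (a1 a2 a3 : nat) : Prop :=
  exists F1 F2 F3 : R,
    [/\ trihom (a1, 0, 0)%N F1, trihom (0, a2, 0)%N F2, trihom (0, 0, a3)%N F3,
        regseq_mod zero_ideal [:: F1; F2; F3] &
        forall f, I_pts C f <-> gen [:: F1; F2; F3] f].

(* the unique linear form of degree e_i vanishing at the i-th coordinate of P:
   v_i x_{i,0} - u_i x_{i,1} *)
Definition lform (P : point) (i : 'I_3) : R :=
  (P i).2 *: xvar i 0 - (P i).1 *: xvar i 1.

(* I_{X_C}: intersection of the ideals (F,G) of all lines L(F,G) through points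
   of C; the line through P of type {e_i,e_j} is L(lform P i, lform P j). *)
Definition I_grid (C : seq point) (f : R) : Prop :=
  forall P, P \in C -> forall i j : 'I_3, i != j ->
    gen [:: lform P i; lform P j] f.

(* A trigraded minimal free resolution of J of the form
   0 -> R^2(-a,-b,-c) --M--> R(-a,-b,0) (+) R(-a,0,-c) (+) R(0,-b,-c) --(G1 G2 G3)--> J -> 0
   where M = [[m11 m12];[m21 m22];[m31 m32]]. *)
Definition grid_resolution (J : R -> Prop) (a b c : nat) : Prop :=
  exists G1 G2 G3 m11 m12 m21 m22 m31 m32 : R,
      (trihom (a, b, 0)%N G1 /\ trihom (a, 0, c)%N G2 /\ trihom (0, b, c)%N G3 /\
       trihom (0, 0, c)%N m11 /\ trihom (0, 0, c)%N m12 /\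
       trihom (0, b, 0)%N m21 /\ trihom (0, b, 0)%N m22 /\
       trihom (a, 0, 0)%N m31 /\ trihom (a, 0, 0)%N m32) /\
      (forall f, J f <-> exists h1 h2 h3, f = h1 * G1 + h2 * G2 + h3 * G3) /\
      (m11 * G1 + m21 * G2 + m31 * G3 = 0 /\ m12 * G1 + m22 * G2 + m32 * G3 = 0) /\
      (forall h1 h2 h3, h1 * G1 + h2 * G2 + h3 * G3 = 0 ->
         exists s t, [/\ h1 = m11 * s + m12 * t, h2 = m21 * s + m22 * t
                       & h3 = m31 * s + m32 * t]) /\
      (forall s t, m11 * s + m12 * t = 0 -> m21 * s + m22 * t = 0 ->
         m31 * s + m32 * t = 0 -> s = 0 /\ t = 0) /\
      (* minimality: the entries of the differential lie in (x_{i,j}) *)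
      (in_irrel m11 /\ in_irrel m12 /\ in_irrel m21 /\ in_irrel m22 /\
       in_irrel m31 /\ in_irrel m32).

End GridDefs.

(* Main.v *)
(**
Let [D i] be the set of [i]-th coordinates of the points of [C] and [Q i] the
product of the linear forms vanishing at the points of [D i].  Both [F i] and
[Q i] vanish on [C], which forces [F i] to be a scalar multiple of [Q i] and [C]
to be the full grid [D 0 x D 1 x D 2].  Hence the ideal of the grid of lines is
the intersection of the ideals [(l, m)] with [l] a factor of [Q i] and [m] a
factor of [Q j], [i <> j].

Choose a further linear form [A i] in each group of variables that is
proportional to no factor of [Q i].  Ideals generated by linear forms are prime,
and a linear form outside the span of the generators is a non-zero-divisor;
passing to products, [Q 0, Q 1, Q 2, A 0, A 1, A 2] is a regular sequence in any
order.  It follows that the ideal of the grid is [(Q 0 Q 1, Q 0 Q 2, Q 1 Q 2)],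
with the obvious Hilbert-Burch syzygies, and that [A 0, A 1, A 2, Q 0 + Q 1 + Q 2]
is a regular sequence on the quotient.  The quotient has dimension 4: a prime
containing it contains some [(l, m)], so a longer chain would extend to a chain of
eight primes in six variables, which the algebraic dependence of seven
polynomials in six variables forbids.
*)
Require Import Defs.
From HB Require Import structures.
From mathcomp Require Import all_boot all_order all_algebra.
From mathcomp Require Import mpoly.
From mathcomp Require Import ring zify.
Set Implicit Arguments. Unset Strict Implicit. Unset Printing Implicit Defensive.
Import GRing.Theory.
Local Open Scope ring_scope.

(** * Ideals and non-zero-divisors *)

Section Ideals.
Variable K : fieldType.
Local Notation R := {mpoly K[6]}.
Implicit Types (J : R -> Prop) (f g x y : R) (s t : seq R).

(** The ideal [(J, x)], with one multiplier in place of the coefficient list of [span_with], so that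
    generators can be handled one at a time. *)
Definition addI J x f : Prop := exists r, J (f - r * x).

Lemma span_with_nil J f : span_with J [::] f <-> J f.
Proof.
split=> [[g [cs [Jg ->]]]|Jf]; first by rewrite big_ord0 addr0.
by exists f, [::]; rewrite big_ord0 addr0.
Qed.

Lemma span_with_cons J x s f :
  span_with J (x :: s) f <-> exists r, span_with J s (f - r * x).
Proof.
split=> [[g [cs [Jg ->]]]|[r [g [cs [Jg e]]]]].
  exists cs`_0, g, (behead cs); split=> //.
  rewrite /= big_ord_recl /= addrCA addrAC subrr add0r.
  by congr (_ + _); apply: eq_bigr => k _; rewrite nth_behead.
exists g, (r :: cs); split=> //=.
by rewrite big_ord_recl /= addrCA -e addrC subrK.
Qed.

Lemma gen_nil f : gen [::] f <-> f = 0.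
Proof. exact: span_with_nil. Qed.

Lemma gen_cons x s f : gen (x :: s) f <-> addI (gen s) x f.
Proof. exact: span_with_cons. Qed.

Lemma addI_ideal J x : is_ideal J -> is_ideal (addI J x).
Proof.
move=> [J0 JD JM]; split=> [|f g [r Jr] [q Jq]|h f [r Jr]].
- by exists 0; rewrite mul0r subr0.
- by exists (r + q); rewrite mulrDl opprD addrACA; apply: JD.
- by exists (h * r); rewrite -mulrA -mulrBr; apply: JM.
Qed.

Lemma gen_ideal s : is_ideal (gen s).
Proof.
elim: s => [|x s /(addI_ideal x) [J0 JD JM]].
  split=> [|f g /gen_nil -> /gen_nil ->|r f /gen_nil ->]; apply/gen_nil => //.
    by rewrite addr0.
  by rewrite mulr0.
split=> [|f g /gen_cons Jf /gen_cons Jg|r f /gen_cons Jf]; apply/gen_cons => //.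
  exact: JD.
exact: JM.
Qed.

Lemma ideal0 J : is_ideal J -> J 0. Proof. by case. Qed.
Lemma idealD J f g : is_ideal J -> J f -> J g -> J (f + g).
Proof. by case=> _ + _; apply. Qed.
Lemma idealM J r f : is_ideal J -> J f -> J (r * f).
Proof. by case=> _ _; apply. Qed.
Lemma idealN J f : is_ideal J -> J f -> J (- f).
Proof. by move=> iJ Jf; rewrite -mulN1r; apply: idealM. Qed.
Lemma idealB J f g : is_ideal J -> J f -> J g -> J (f - g).
Proof. by move=> iJ Jf Jg; apply: idealD => //; apply: idealN. Qed.

Lemma gen_sub J s f : is_ideal J -> (forall x, x \in s -> J x) -> gen s f -> J f.
Proof.
move=> iJ; elim: s f => [|x s IHs] f sJ; first by move=> /gen_nil ->; apply: ideal0.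
case/gen_cons=> r /IHs Jfr; rewrite -[f](subrK (r * x)).
apply: idealD => //; last by apply: idealM => //; apply: sJ; rewrite mem_head.
by apply: Jfr => y ys; apply: sJ; rewrite inE ys orbT.
Qed.

Lemma gen_mem x s : x \in s -> gen s x.
Proof.
elim: s => // y s IHs; rewrite inE => /predU1P[->|/IHs xs]; apply/gen_cons.
  by exists 1; rewrite mul1r subrr; apply: ideal0 (gen_ideal s).
by exists 0; rewrite mul0r subr0.
Qed.

Lemma gen_mulmem r x s : x \in s -> gen s (r * x).
Proof. by move/gen_mem; apply: idealM; apply: gen_ideal. Qed.

Lemma gen_sub_gen s t f : (forall x, x \in s -> gen t x) -> gen s f -> gen t f.
Proof. by apply: gen_sub; apply: gen_ideal. Qed.

Lemma gen_subset s t f : {subset s <= t} -> gen s f -> gen t f.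
Proof. by move=> st; apply: gen_sub_gen => x /st; apply: gen_mem. Qed.

(** Turns a question modulo [J] and [s] into one about a single list of generators, to which the
    results on products of linear forms apply. *)
Lemma span_with_gen J u s f : (forall f, J f <-> gen u f) ->
  span_with J s f <-> gen (s ++ u) f.
Proof.
move=> Ju; elim: s f => [|x s IHs] f; first by rewrite span_with_nil.
by rewrite span_with_cons /= gen_cons; split=> -[r /IHs ?]; exists r.
Qed.

Lemma nzd_equiv J1 J2 g : (forall f, J1 f <-> J2 f) -> nzd_mod J1 g -> nzd_mod J2 g.
Proof. by move=> e n f /e /n /e. Qed.

Lemma nzd_gen_eq s t g : s =i t -> nzd_mod (gen s) g -> nzd_mod (gen t) g.
Proof. by move=> st; apply: nzd_equiv => f; split; apply: gen_subset => x; rewrite st. Qed.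

Lemma nzd_congr J g h : is_ideal J -> J (h - g) -> nzd_mod J g -> nzd_mod J h.
Proof.
move=> iJ Jhg ng f Jfh; apply: ng; rewrite (_ : f * g = f * h - f * (h - g)); last by ring.
by apply: idealB => //; apply: idealM.
Qed.

Lemma nzdM J g h : nzd_mod J g -> nzd_mod J h -> nzd_mod J (g * h).
Proof. by move=> ng nh f; rewrite mulrA => /nh/ng. Qed.

Lemma nzd_prod J s : (forall x, x \in s -> nzd_mod J x) -> nzd_mod J (\prod_(x <- s) x).
Proof.
elim: s => [|x s IHs] H; first by move=> f; rewrite big_nil mulr1.
rewrite big_cons; apply: nzdM; first by apply: H; rewrite mem_head.
by apply: IHs => y ys; apply: H; rewrite inE ys orbT.
Qed.

Lemma addI_mul J x y f : is_ideal J -> addI J (x * y) f -> addI J x f.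
Proof. by move=> iJ [r Jr]; exists (r * y); rewrite -mulrA (mulrC y). Qed.

(* The inclusion [(J, x y) <= (J, x)] has quotient [(J, x) / (J, x y)], which is
   [R / (J, y)] because [x] is a non-zero-divisor. *)
Lemma nzd_addI_mul J x y g : is_ideal J -> nzd_mod J x ->
  nzd_mod (addI J x) g -> nzd_mod (addI J y) g -> nzd_mod (addI J (x * y)) g.
Proof.
move=> iJ nx ngx ngy f Jfg; have [q Jfq] := ngx _ (addI_mul iJ Jfg).
have [r Jr] := Jfg; suff /ngy[p Jp] : addI J y (q * g).
  exists p; rewrite (_ : f - _ = (f - q * x) + x * (q - p * y)); last by ring.
  by apply: idealD => //; apply: idealM.
exists r; apply: nx; rewrite (_ : _ * x = (f * g - r * (x * y)) - g * (f - q * x)); last by ring.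
by apply: idealB => //; apply: idealM.
Qed.

(** If [f] is congruent to [r * x] modulo [J] and lies in [(J, y)], then [r * x] lies in [(J, y)],
    hence so does [r]; this puts [r * x] into [(J, x * y)]. *)
Lemma addI_inter J x y f : is_ideal J -> nzd_mod (addI J y) x ->
  addI J x f -> addI J y f -> addI J (x * y) f.
Proof.
move=> iJ nx [r Jr] [q Jq]; have [p Jp] : addI J y r.
  apply: nx; exists q.
  rewrite (_ : _ - _ = (f - q * y) - (f - r * x)); last by ring.
  exact: idealB.
exists p; rewrite (_ : _ - _ = (f - r * x) + x * (r - p * y)); last by ring.
by apply: idealD => //; apply: idealM.
Qed.

(** Write [f] as [p * x + q * y] modulo [s]. Membership in [(x, z, s)] puts [q * y], hence [q], into
    that ideal. Expanding [q] as [q1 * x + q2 * z] turns the coefficient of [x] into [p + q1 * y],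
    which membership in [(y, z, s)] puts into [(y, z, s)]. *)
Lemma gen_pairwise_products x y z s f :
  nzd_mod (gen [:: x, z & s]) y -> nzd_mod (gen [:: y, z & s]) x ->
  gen [:: x, y & s] f -> gen [:: x, z & s] f -> gen [:: y, z & s] f ->
  gen [:: x * y, x * z, y * z & s] f.
Proof.
move=> ny nx Jxy Jxz Jyz.
have /gen_cons[p /gen_cons[q Jpq]] := Jxy.
have id t := gen_ideal t.
have sub t u h : {subset t <= u} -> gen t h -> gen u h by apply: gen_subset.
have Jz : gen [:: x, z & s] q.
  apply: ny; rewrite (_ : q * y = f - p * x - (f - p * x - q * y)); last by ring.
  apply: idealB => //; last first.
    by apply: sub Jpq => w ws; rewrite !inE ws !orbT.
  by apply: idealB => //; apply: gen_mulmem; rewrite mem_head.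
have /gen_cons[q1 /gen_cons[q2 Jq]] := Jz.
have Jx : gen [:: y, z & s] (p + q1 * y).
  apply: nx; rewrite (_ : _ * x = f - (q2 * y) * z - y * (q - q1 * x - q2 * z)
     - (f - p * x - q * y)); last by ring.
  apply: idealB => //; last by apply: sub Jpq => w ws; rewrite !inE ws !orbT.
  apply: idealB => //; last first.
    by apply: idealM (id _) (sub _ _ _ _ Jq) => w ws; rewrite !inE ws !orbT.
  apply: idealB => //; apply: gen_mulmem.
  by rewrite !inE eqxx orbT.
have /gen_cons[p1 /gen_cons[p2 Jp]] := Jx.
apply/gen_cons; exists p1; apply/gen_cons; exists p2; apply/gen_cons; exists q2.
rewrite (_ : _ - _ = (f - p * x - q * y) + y * (q - q1 * x - q2 * z)
   + x * (p + q1 * y - p1 * y - p2 * z)); last by ring.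
by apply: idealD => //; [apply: idealD => //|]; apply: idealM.
Qed.

Lemma gen_pairwise_sub x y z s f : gen [:: x * y, x * z, y * z & s] f ->
  [/\ gen [:: x, y & s] f, gen [:: x, z & s] f & gen [:: y, z & s] f].
Proof.
move=> Jf.
have Hs u v w : w \in s -> gen [:: u, v & s] w.
  by move=> ws; apply: gen_mem; rewrite !inE ws !orbT.
have [m1 m2] : (forall u v, u \in [:: u, v & s]) /\ (forall u v, v \in [:: u, v & s]).
  by split=> u v; rewrite !inE eqxx ?orbT.
split; apply: gen_sub_gen Jf => w; rewrite !inE => /or4P[/eqP->|/eqP->|/eqP->|/Hs //];
  first [exact: gen_mulmem | rewrite mulrC; exact: gen_mulmem].
Qed.

(** The ideal is the intersection of three ideals, and [g] can be cancelled in each of them. *)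
Lemma nzd_pairwise_products x y z s g :
  nzd_mod (gen [:: x, z & s]) y -> nzd_mod (gen [:: y, z & s]) x ->
  nzd_mod (gen [:: x, y & s]) g -> nzd_mod (gen [:: x, z & s]) g ->
  nzd_mod (gen [:: y, z & s]) g ->
  nzd_mod (gen [:: x * y, x * z, y * z & s]) g.
Proof.
move=> ny nx n1 n2 n3 f /gen_pairwise_sub[/n1 ? /n2 ? /n3 ?].
exact: gen_pairwise_products.
Qed.

End Ideals.

(** * Ideals of linear forms *)

Section LinearForms.
Variable K : fieldType.
Local Notation R := {mpoly K[6]}.
Local Notation V := 'rV[K]_6.
Implicit Types (U : {vspace V}) (v w : V) (vs : seq V) (f g : R).

Definition lin v : R := \sum_k v 0 k *: 'X_k.

Lemma lin_is_linear : linear lin.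
Proof.
move=> k v w; rewrite /lin scaler_sumr -big_split; apply: eq_bigr => i _ /=.
by rewrite !mxE scalerDl scalerA.
Qed.
HB.instance Definition _ := GRing.isLinear.Build K V R _ lin lin_is_linear.

Lemma linZ k v : lin (k *: v) = k *: lin v.
Proof. exact: linearZ. Qed.

Lemma lin_delta (i : 'I_6) : lin (delta_mx 0 i) = 'X_i.
Proof.
rewrite /lin (bigD1 i) //= mxE !eqxx scale1r big1 ?addr0 // => j jNi.
by rewrite mxE (negPf jNi) andbF scale0r.
Qed.

Lemma lin_eq0 v : lin v = 0 -> v = 0.
Proof.
move=> lv0; apply/rowP=> i; rewrite mxE; have := congr1 (mcoeff U_(i)) lv0.
rewrite /lin mcoeff0 linear_sum /= (bigD1 i) //= mcoeffZ mcoeffXU eqxx mulr1.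
rewrite big1 ?addr0 // => j jNi.
by rewrite mcoeffZ mcoeffXU (negPf jNi) mulr0.
Qed.

(** Substitution is a ring map that agrees with the identity modulo [J] on the variables, hence on
    all polynomials. *)
Lemma ideal_subst (J : R -> Prop) (lq : 6.-tuple R) f : is_ideal J ->
  (forall i, J ('X_i - tnth lq i)) -> J (f - (f \mPo lq)).
Proof.
move=> iJ JX; elim/mpolyind: f => [|c m f _ _ IHf].
  by rewrite linear0 subrr; apply: ideal0.
rewrite linearD opprD addrACA; apply: idealD => //.
rewrite linearZ /= -scalerBr -mul_mpolyC; apply: idealM => //.
rewrite comp_mpolyX [X in X - _]mpolyXE_id.
apply: (big_ind2 (fun x y : R => J (x - y))) => [|x x' y y' Jx Jy|i _].
- by rewrite subrr; apply: ideal0.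
- rewrite (_ : _ - _ = y * (x - x') + x' * (y - y')); last by ring.
  by apply: idealD => //; apply: idealM.
elim: (m i) => [|k IHk]; first by rewrite !expr0 subrr; apply: ideal0.
rewrite !exprS (_ : _ - _ = 'X_i ^+ k * ('X_i - tnth lq i)
  + tnth lq i * ('X_i ^+ k - tnth lq i ^+ k)); last by ring.
by apply: idealD => //; apply: idealM.
Qed.

(** Images of the variables under the ring endomorphism that subtracts from a linear form its
    projection to [U]. *)
Definition proj_coords U : 6.-tuple R :=
  [tuple lin (delta_mx 0 i - projv U (delta_mx 0 i)) | i < 6].

Lemma lin_proj U v : lin v \mPo proj_coords U = lin (v - projv U v).
Proof.
rewrite /lin linear_sum /=; under eq_bigr do rewrite comp_mpolyZ comp_mpolyXU.
under eq_bigr do rewrite -tnth_nth tnth_mktuple -linearZ.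
rewrite -linear_sum; congr lin.
rewrite [in RHS](row_sum_delta v) linear_sum -sumrB; apply: eq_bigr => i _.
by rewrite linearZ scalerBr.
Qed.

Lemma gen_lin_span vs v : v \in <<vs>>%VS -> gen (map lin vs) (lin v).
Proof.
elim: vs v => [|w vs IHvs] v.
  by rewrite span_nil memv0 => /eqP ->; rewrite linear0; apply/gen_nil.
rewrite span_cons => /memv_addP[_ /vlineP[k ->] [u /IHvs u_vs ->]].
apply/gen_cons; exists k%:MP; rewrite linearD linearZ /= mul_mpolyC.
by rewrite addrAC subrr add0r.
Qed.

(** Exhibits the ideal as the kernel of an endomorphism of a domain, which makes it prime. A kernel
    element lies in the ideal because each variable differs from its image by a form in the span. *)
Lemma gen_linE vs f :
  gen (map lin vs) f <-> f \mPo proj_coords <<vs>> = 0.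
Proof.
split=> [|f0].
  apply: (@gen_sub _ (fun h => h \mPo proj_coords <<vs>> = 0)) => [|_ /mapP[v v_vs ->]].
    split=> [|p q p0 q0|p q q0]; first by rewrite linear0.
      by rewrite linearD /= p0 q0 addr0.
    by rewrite rmorphM /= q0 mulr0.
  by rewrite lin_proj projv_id ?memv_span // subrr linear0.
rewrite -[f]subr0 -f0; apply: ideal_subst (gen_ideal _) _ => i.
rewrite tnth_mktuple -lin_delta -linearB opprB addrC subrK.
exact/gen_lin_span/memv_proj.
Qed.

Lemma gen_lin_memE vs v : gen (map lin vs) (lin v) <-> v \in <<vs>>%VS.
Proof.
split=> [/gen_linE|]; last exact: gen_lin_span.
rewrite lin_proj => /lin_eq0/eqP; rewrite subr_eq0 => /eqP ->; exact: memv_proj.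
Qed.

Lemma gen_lin_prime vs : is_prime (gen (map lin vs)).
Proof.
split; [exact: gen_ideal | |].
  by move/gen_linE; rewrite rmorph1 => /eqP; rewrite oner_eq0.
move=> f g /gen_linE; rewrite rmorphM => /eqP; rewrite mulf_eq0.
by case/orP=> /eqP ?; [left|right]; apply/gen_linE.
Qed.

Lemma nzd_lin v vs : v \notin <<vs>>%VS -> nzd_mod (gen (map lin vs)) (lin v).
Proof.
move=> vNvs f; case: (gen_lin_prime vs) => _ _ /[apply] -[] // /gen_lin_memE.
by rewrite (negPf vNvs).
Qed.

(** * Regularity of products of linear forms *)

Definition choices (ts : seq (seq V)) (vs : seq V) : bool :=
  all2 (fun v (t : seq V) => v \in t) vs ts.

Definition lprod (t : seq V) : R := \prod_(v <- t) lin v.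

Lemma nzd_gen_unit (s : seq R) g : 1 \in s -> nzd_mod (gen s) g.
Proof. by move=> s1 f _; rewrite -[f]mulr1; apply: gen_mulmem. Qed.

(* Replacing the linear forms of an independent family by products of such forms
   preserves regularity, one factor at a time through [nzd_addI_mul]. *)
Lemma nzd_lprods ts ds (g : V) :
  (forall vs, choices ts vs -> free (g :: vs ++ ds)) ->
  nzd_mod (gen (map lprod ts ++ map lin ds)) (lin g).
Proof.
elim: ts ds g => [|t ts IHts] ds g H /=.
  by apply: nzd_lin; have := H [::] isT; rewrite free_cons => /andP[].
elim: t H => [|v t IHt] H.
  by apply: nzd_gen_unit; rewrite /lprod big_nil mem_head.
have Hv vs : choices ts vs -> free [:: g, v & vs ++ ds].
  by move=> c; apply: (H (v :: vs)); rewrite /choices /= mem_head.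
apply: nzd_equiv (fun f => iff_sym (gen_cons _ _ _)) _.
rewrite /lprod big_cons; apply: nzd_addI_mul; first exact: gen_ideal.
- by apply: IHts => vs /Hv; rewrite free_cons => /andP[].
(* Modulo [lin v] the first product disappears: [v] joins [ds] and one product fewer remains. *)
- apply: nzd_equiv (fun f => gen_cons _ _ _) _.
  apply: (@nzd_gen_eq _ (map lprod ts ++ map lin (v :: ds))).
    by move=> x; rewrite !(inE, mem_cat) orbCA.
  apply: IHts => vs /Hv; congr is_true; apply: perm_free.
  by rewrite perm_cons -cat1s perm_catCA.
- apply: nzd_equiv (fun f => gen_cons _ _ _) _.
  apply: IHt => -[|w vs] // /andP[w_t c]; apply: H.
  by rewrite /choices /= inE w_t orbT.
Qed.

End LinearForms.

(** * Krull dimension *)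

Section AlgebraicDependence.
Variables (K : fieldType) (n : nat).
Local Notation S := {mpoly K[n]}.

Definition bounded_deg d (p : S) : Prop := forall m, m \in msupp p -> (mdeg m <= d)%N.

Lemma bounded_degM d e (p q : S) :
  bounded_deg d p -> bounded_deg e q -> bounded_deg (d + e) (p * q).
Proof.
move=> pd qe m /msuppM_le/allpairsP[[m1 m2] /= [/pd m1d /qe m2e ->]].
by rewrite mdegD leq_add.
Qed.

Lemma bounded_deg1 : bounded_deg 0 1.
Proof. by move=> m; rewrite msupp1 inE => /eqP ->; rewrite mdeg0. Qed.

Lemma bounded_degX d k (p : S) : bounded_deg d p -> bounded_deg (d * k) (p ^+ k).
Proof.
move=> pd; elim: k => [|k IHk]; first by rewrite muln0 expr0; apply: bounded_deg1.
by rewrite exprS mulnS; apply: bounded_degM.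
Qed.

Lemma bounded_deg_prod (I : Type) (r : seq I) (D : I -> nat) (F : I -> S) :
  (forall i, bounded_deg (D i) (F i)) ->
  bounded_deg (\sum_(i <- r) D i) (\prod_(i <- r) F i).
Proof.
move=> DF; elim: r => [|i r IHr]; first by rewrite !big_nil; apply: bounded_deg1.
by rewrite !big_cons; apply: bounded_degM.
Qed.

(* The [D ^ n.+1] power products with exponents below [D] lie in the span of the
   fewer than [(k * D) ^ n] monomials of degree below [k * D]. *)
Lemma mpoly_alg_dependent (x : 'I_n.+1 -> S) :
  exists (D : nat) (c : {ffun 'I_n.+1 -> 'I_D} -> K),
    (exists e, c e != 0) /\ \sum_e c e *: \prod_i x i ^+ e i = 0.
Proof.
(* Power products have degree at most [n.+1 * d * D], less than [k * D], so [F] indexes enough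
   monomials; [D = k ^ n + 1] gives [(k * D) ^ n < D ^ n.+1]. *)
pose d := \max_i msize (x i); pose k := (n.+1 * d).+1; pose D := (k ^ n).+1.
pose E := {ffun 'I_n.+1 -> 'I_D}; pose F := {ffun 'I_n -> 'I_(k * D)}.
pose pow (e : E) : S := \prod_i x i ^+ e i.
have powd e : bounded_deg (n.+1 * d * D) (pow e).
  have: bounded_deg (\sum_(i < n.+1) d * e i)%N (pow e).
    apply: bounded_deg_prod => i; apply: bounded_degX => m /msize_mdeg_lt m_lt.
    by rewrite (leq_trans (ltnW m_lt)) // /d (leq_bigmax i).
  move=> h m /h /leq_trans -> //; rewrite -big_distrr /= [leqRHS]mulnAC mulnC leq_mul2r.
  by rewrite -[n.+1 in leqRHS]card_ord -sum_nat_const leq_sum ?orbT // => i _; rewrite ltnW.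
pose M := \matrix_(i < #|E|, j < #|F|)
  (pow (enum_val i))@_[multinom (enum_val j l : nat) | l < n].
have /rowV0Pn[v /sub_kermxP vM v0] : kermx M != 0.
  rewrite kermx_eq0 -row_leq_rank -ltnNge (leq_ltn_trans (rank_leq_col M)) //.
  rewrite !card_ffun !card_ord expnMn expnS ltn_mul2r expn_gt0 /=.
  by rewrite /D ltnS leqnn.
exists D, (fun e => v 0 (enum_rank e)); split.
  have [j vj] := rV0Pn _ v0; exists (enum_val j); by rewrite enum_valK.
apply/mpolyP => m; rewrite mcoeff0 linear_sum /=.
(* A monomial indexed by [F] is a column of [M], killed by [v]; any other monomial exceeds the
   degree bound and occurs in no power product. *)
have [small|/forallPn[l l_big]] := boolP [forall l, m l < k * D]%N.
  have := congr1 (fun w : 'rV_ _ => w 0 (enum_rank [ffun l => Ordinal (forallP small l)])) vM.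
  rewrite !mxE (reindex (@enum_rank E)) /=; last by apply: onW_bij; apply: enum_rank_bij.
  move=> vM0; rewrite -[RHS]vM0; apply: eq_bigr => e _; rewrite mcoeffZ !mxE !enum_rankK.
  congr (_ * mcoeff _ _); apply/mnmP => l; by rewrite mnmE ffunE.
rewrite big1 // => e _; rewrite mcoeffZ memN_msupp_eq0 ?mulr0 //.
apply/negP => /powd m_small; case/negP: l_big.
have: (m l <= mdeg m)%N by rewrite mdegE (bigD1 l) //= leq_addr.
by rewrite /k; nia.
Qed.

End AlgebraicDependence.

(* Choosing [x k] in [P k.+1] but not in [P k] along a chain of primes, the
   lexicographically lowest coefficient of a relation among the [x k] ends up
   in the largest prime. *)
Lemma no_prime_chain7 (K : fieldType) : ~ prime_chain (@zero_ideal K) 7.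
Proof.
case=> P [Pprime chain]; pose S := {mpoly K[6]}.
have iP k : (k <= 7)%N -> is_ideal (P k) by case/Pprime=> -[].
have [x Hx] : exists x : 'I_7 -> S, forall i : 'I_7, P i.+1 (x i) /\ ~ P i (x i).
  apply: (@fin_all_exists 'I_7 (fun=> S) (fun i y => P i.+1 y /\ ~ P i y)) => i.
  by have [_] := chain i (ltn_ord i).
have [D [c [[e0 ce0] csum]]] := mpoly_alg_dependent x.
pose E := {ffun 'I_7 -> 'I_D}.
pose tail k (e : E) : S := \prod_(i < 7 | (k <= i)%N) x i ^+ e i.
have PX k f j i : (k <= 7)%N -> ~ P k f -> P k (f ^+ i * j) -> P k j.
  move=> /Pprime[[_ _ Pk] _] Pf; elim: i => [|i IHi]; first by rewrite expr0 mul1r.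
  by rewrite exprS -mulrA => /Pk[].
(* Invariant: the exponents in [A] agree on the first [k] coordinates, and their part of the
   relation, stripped of the first [k] variables, lies in [P k]. *)
have low k : (k <= 7)%N -> exists A : {set E}, exists2 e, e \in A &
    (forall e', e' \in A -> c e' != 0 /\ forall i : 'I_7, (i < k)%N -> e' i = e i)
    /\ P k (\sum_(e' in A) c e' *: tail k e').
  elim: k => [_|k IHk kn].
    exists [set e | c e != 0], e0; rewrite ?inE //; split.
      by move=> e'; rewrite inE.
    rewrite (_ : \sum_(_ in _) _ = 0); first by apply: ideal0 (iP _ _).
    rewrite -[RHS]csum [RHS](bigID (fun e => c e == 0)) /= [X in _ = X + _]big1 ?add0r.
      by apply: eq_big => [e|e _]; rewrite ?inE.
    by move=> e /eqP ->; rewrite scale0r.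
  have [A [e eA [A1 PA]]] := IHk (ltnW kn); have iP1 := iP _ kn.
  pose ik := Ordinal kn.
  (* The lowest power of [x ik] factors out and is cancelled, as [x ik] is outside the prime [P k];
     in [P k.+1], which contains [x ik], the terms with a higher power drop out. *)
  case: (arg_minnP (fun e' : E => e' ik : nat) eA) => em emA em_min.
  exists [set e' in A | e' ik == em ik], em; first by rewrite inE eqxx andbT.
  split=> [e'|].
    rewrite inE => /andP[/A1[ce' e'E] /eqP e'k]; split=> // i.
    rewrite ltnS leq_eqVlt => /orP[/eqP ik_eq|ik_lt].
      by rewrite (_ : i = ik) //; apply: val_inj.
    by rewrite e'E //; have [_ ->] := A1 _ emA.
  have tailS e' : tail k e' = x ik ^+ e' ik * tail k.+1 e'.
    rewrite /tail (bigD1 ik) //=; congr (_ * _); apply: eq_bigl => i.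
    by rewrite -val_eqE /= [RHS]ltn_neqAle andbC eq_sym.
  have [xk xkN] := Hx ik.
  have /(PX _ _ _ _ (ltnW kn) xkN) : P k (x ik ^+ em ik *
      \sum_(e' in A) c e' *: (x ik ^+ (e' ik - em ik) * tail k.+1 e')).
    congr (P k _): PA; rewrite mulr_sumr; apply: eq_bigr => e' e'A.
    by rewrite tailS -scalerAr mulrA -exprD subnKC ?em_min.
  have [sub _] := chain k kn; move/sub.
  rewrite (bigID (fun e' : E => e' ik == em ik)) /= => Ps.
  suff Ps2 : P k.+1 (\sum_(e' in A | e' ik != em ik)
       c e' *: (x ik ^+ (e' ik - em ik) * tail k.+1 e')).
    have := idealB iP1 Ps Ps2.
    rewrite addrK; congr (P _ _); apply: eq_big => [e'|e' /andP[_ /eqP ->]].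
      by rewrite inE.
    by rewrite subnn expr0 mul1r.
  elim/big_ind: _ => [|f g|e' /andP[e'A e'N]]; [exact: ideal0|exact: idealD|].
  rewrite -mul_mpolyC mulrCA mulrC; apply: idealM => //.
  have : (0 < e' ik - em ik)%N.
    by rewrite subn_gt0 ltn_neqAle em_min // andbT eq_sym.
  by case: (e' ik - em ik)%N => // j _; rewrite exprSr; apply: idealM.
have [A [e eA [A1 PA]]] := low 7%N (leqnn 7).
have [[_ P1 _] _] := Pprime 7%N (leqnn 7); apply: P1.
(* All seven exponents are now fixed, so the sum is one nonzero constant, a unit inside a prime. *)
have Ae : A = [set e].
  apply/setP => e'; rewrite inE; apply/idP/eqP => [/A1[_ e'E]|->//].
  by apply/ffunP => i; apply: e'E.
move: PA; rewrite Ae big_set1 /tail big_pred0 => [|i]; last by rewrite leqNgt ltn_ord.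
move=> /(idealM (c e)^-1%:MP (iP _ (leqnn 7))); rewrite mul_mpolyC scalerA mulVf ?scale1r //.
by have [] := A1 e eA.
Qed.

(** * Linear forms attached to points *)

Notation i0 := (@Ordinal 3 0 isT).
Notation i1 := (@Ordinal 3 1 isT).
Notation i2 := (@Ordinal 3 2 isT).

Lemma ord3P (T : 'I_3 -> Prop) : T i0 -> T i1 -> T i2 -> forall i, T i.
Proof.
by move=> T0 T1 T2 [[|[|[|//]]] Hi]; [move: T0|move: T1|move: T2]; congr T; apply: val_inj.
Qed.

Section Coordinates.
Variable K : fieldType.
Local Notation R := {mpoly K[6]}.
Local Notation V := 'rV[K]_6.
Implicit Types (p q : K * K) (i j : 'I_3) (P : point K) (f g : R).

(** Vanishing of the 2 by 2 determinant: for nonzero pairs, equality as points of the projective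
    line. *)
Definition par p q : bool := p.1 * q.2 == p.2 * q.1.

Lemma par_sym p q : par p q = par q p.
Proof. by rewrite /par eq_sym [p.2 * _]mulrC [p.1 * _]mulrC. Qed.

Lemma par_refl p : par p p.
Proof. by rewrite /par mulrC. Qed.

Lemma nonpar_indep p q (k l : K) : ~~ par p q ->
  k * p.1 + l * q.1 = 0 -> k * p.2 + l * q.2 = 0 -> k = 0 /\ l = 0.
Proof.
case: p q => [p1 p2] [q1 q2]; rewrite /par -subr_eq0 /= => pq e1 e2.
split; apply: (mulIf pq); rewrite mul0r.
  rewrite (_ : k * _ = q2 * (k * p1 + l * q1) - q1 * (k * p2 + l * q2)); last by ring.
  by rewrite e1 e2 !mulr0 subrr.
rewrite (_ : l * _ = p1 * (k * p2 + l * q2) - p2 * (k * p1 + l * q1)); last by ring.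
by rewrite e1 e2 !mulr0 subrr.
Qed.

Definition lv i p : V :=
  p.2 *: delta_mx 0 (inord (2 * i)) - p.1 *: delta_mx 0 (inord (2 * i + 1)).

Lemma lform_lin P i : lform P i = lin (lv i (P i)).
Proof. by rewrite /lv linearB /= !linZ !lin_delta /lform /xvar /= addn0. Qed.

Lemma lv_even i j p : lv i p 0 (inord (2 * j)) = if j == i then p.2 else 0.
Proof.
rewrite !mxE /= -!val_eqE /= !inordK; try by have := ltn_ord i; have := ltn_ord j; lia.
rewrite eqn_mul2l /= (_ : (2 * j == 2 * i + 1)%N = false); last by lia.
by case: ifP => _; rewrite ?mulr1 ?mulr0 subr0.
Qed.

Lemma lv_odd i j p : lv i p 0 (inord (2 * j + 1)) = if j == i then - p.1 else 0.
Proof.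
rewrite !mxE /= -!val_eqE /= !inordK; try by have := ltn_ord i; have := ltn_ord j; lia.
rewrite eqn_add2r eqn_mul2l /= (_ : (2 * j + 1 == 2 * i)%N = false); last by lia.
by case: ifP => _; rewrite ?mulr1 ?mulr0 ?sub0r ?oppr0.
Qed.

Let rvD (v w : V) l : (v + w) 0 l = v 0 l + w 0 l. Proof. by rewrite mxE. Qed.
Let rvZ c (v : V) l : (c *: v) 0 l = c * v 0 l. Proof. by rewrite mxE. Qed.
Let rv0 l : (0 : V) 0 l = 0. Proof. by rewrite mxE. Qed.

(** Positions [i] and [i + 3] hold the two forms of the [i]-th group of variables, in the order of
    [axis_forms] below. *)
Definition frame (p q : 'I_3 -> K * K) : seq V :=
  [:: lv i0 (p i0); lv i1 (p i1); lv i2 (p i2);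
      lv i0 (q i0); lv i1 (q i1); lv i2 (q i2)].

(** A linear relation splits by groups of variables into three 2 by 2 systems with nonzero
    determinant. *)
Lemma frame_free (p q : 'I_3 -> K * K) :
  (forall i, ~~ par (p i) (q i)) -> free (frame p q).
Proof.
move=> pq; rewrite -[frame p q]/(tval (in_tuple (frame p q))).
apply/freeP => k.
rewrite !big_ord_recl big_ord0 /= => e.
have e1 j := congr1 (fun w : V => w 0 (inord (2 * j))) e.
have e2 j := congr1 (fun w : V => w 0 (inord (2 * j + 1))) e.
have /= H j := conj (e1 j) (e2 j); move: {e e1 e2} (H i0) (H i1) (H i2) => {H}.
rewrite !(lv_even, lv_odd, rvZ, rvD, rv0) /=.
rewrite !mulr0 !mulrN !addr0 !add0r.
have N (x y : K) : - x - y = 0 -> x + y = 0.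
  by move=> xy; apply: oppr_inj; rewrite opprD oppr0.
move=> [a0 /N b0] [a1 /N b1] [a2 /N b2].
have [c0 c3] := nonpar_indep (pq i0) b0 a0.
have [c1 c4] := nonpar_indep (pq i1) b1 a1.
have [c2 c5] := nonpar_indep (pq i2) b2 a2.
case=> -[|[|[|[|[|[|//]]]]]] Hi;
  [move: c0|move: c1|move: c2|move: c3|move: c4|move: c5];
  by congr (k _ = 0); apply: val_inj.
Qed.

Lemma free_lv3 i j p q r : i != j -> ~~ par p q -> r != (0, 0) ->
  free [:: lv i p; lv i q; lv j r].
Proof.
move=> ij pq r0; rewrite -[[:: _; _; _]]/(tval (in_tuple [:: lv i p; lv i q; lv j r])).
apply/freeP => k.
rewrite !big_ord_recl big_ord0 /= addr0 => e.
have e1 l := congr1 (fun w : V => w 0 (inord (2 * l))) e.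
have e2 l := congr1 (fun w : V => w 0 (inord (2 * l + 1))) e.
have /= H l := conj (e1 l) (e2 l); move: {e e1 e2} (H i) (H j) => {H}.
rewrite !(lv_even, lv_odd, rvZ, rvD, rv0).
rewrite !eqxx [j == i]eq_sym (negPf ij) !mulr0 !mulrN !addr0 !add0r.
have N (x y : K) : - x - y = 0 -> x + y = 0.
  by move=> xy; apply: oppr_inj; rewrite opprD oppr0.
move=> [a0 /N b0] [a1 b1].
have [c0 c1] := nonpar_indep pq b0 a0.
have c2 : k (lift ord0 (lift ord0 ord0)) = 0.
  apply/eqP; apply: contraNT r0 => k0; case: (r) a1 b1 => r1 r2 /= /eqP + /eqP.
  by rewrite oppr_eq0 !mulf_eq0 (negPf k0) /= => /eqP -> /eqP ->.
case=> -[|[|[|//]]] Hi; [move: c0|move: c1|move: c2];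
  by congr (k _ = 0); apply: val_inj.
Qed.

Lemma free_nth (t : seq V) (ns : seq nat) :
  free t -> uniq ns -> all (fun k => (k < size t)%N) ns ->
  free [seq nth 0 t k | k <- ns].
Proof.
move=> t_free ns_uniq /allP ns_lt; have t_uniq := free_uniq t_free.
have: free [seq x <- t | x \in [seq nth 0 t k | k <- ns]] by apply: filter_free.
congr is_true; apply: perm_free; apply: uniq_perm; first exact: filter_uniq.
  rewrite map_inj_in_uniq // => k l /ns_lt kt /ns_lt lt /eqP.
  by rewrite nth_uniq // => /eqP.
move=> x; rewrite mem_filter andb_idr // => /mapP[k /ns_lt kt ->].
exact: mem_nth.
Qed.

(** Intersects the ideals [(l, s)] one linear factor [l] at a time through [addI_inter]; each new
    factor must be a non-zero-divisor modulo [s] and the product of the later ones. *)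
Lemma gen_lprod i (D : seq (K * K)) (s : seq R) f :
  pairwise (fun p q => ~~ par p q) D ->
  (forall p (D' : seq (K * K)), {subset p :: D' <= D} -> all (fun q => ~~ par p q) D' ->
     nzd_mod (gen (lprod (map (lv i) D') :: s)) (lin (lv i p))) ->
  (forall p, p \in D -> gen (lin (lv i p) :: s) f) ->
  gen (lprod (map (lv i) D) :: s) f.
Proof.
elim: D => [|p D IHD] /=.
  by move=> _ _ _; rewrite -[f]mulr1 /lprod big_nil; apply/gen_mulmem/mem_head.
move=> /andP[pD D_pw] nzd Hf; rewrite /lprod big_cons; apply/gen_cons.
apply: addI_inter; first exact: gen_ideal.
- by apply: nzd_equiv (nzd p D _ pD) => // g; apply: gen_cons.
- by apply/gen_cons/Hf/mem_head.
apply/gen_cons; apply: IHD => // [q D' sub|q qD]; last by apply: Hf; rewrite inE qD orbT.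
by apply: nzd => r /sub rD; rewrite inE rD orbT.
Qed.

Lemma lprod_vanish i (D : seq (K * K)) p (v : 'I_6 -> K) :
  p \in D -> (lin (lv i p)).@[v] = 0 -> (lprod (map (lv i) D)).@[v] = 0.
Proof.
move=> pD v0; rewrite /lprod big_map (big_rem p) //= mevalM v0 mul0r //.
Qed.

Lemma gen_lprod_mem i (D : seq (K * K)) p (s : seq R) :
  p \in D -> lin (lv i p) \in s -> gen s (lprod (map (lv i) D)).
Proof.
by move=> pD ps; rewrite /lprod big_map (big_rem p) //= mulrC; apply: gen_mulmem.
Qed.

Lemma meval_lform i p P : (lin (lv i p)).@[pt_vec P] = p.2 * (P i).1 - p.1 * (P i).2.
Proof.
rewrite /lv linearB /= !linZ !lin_delta mevalB !mevalZ !mevalXU /pt_vec.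
rewrite !inordK; try by have := ltn_ord i; lia.
rewrite oddD oddM /= (_ : (2 * i) %/ 2 = i)%N; last by lia.
rewrite (_ : (2 * i + 1) %/ 2 = i)%N; last by lia.
by rewrite inord_val.
Qed.

Lemma meval_lform_eq0 i p P : ((lin (lv i p)).@[pt_vec P] == 0) = par p (P i).
Proof. by rewrite meval_lform subr_eq0 eq_sym. Qed.

Lemma par_scale i p q : p != (0, 0) -> q != (0, 0) -> par p q ->
  exists k : K, lv i p = k *: lv i q.
Proof.
case: p q => [p1 p2] [q1 q2] p0 q0 /eqP /= pq.
suff [k -> ->] : exists2 k : K, p1 = k * q1 & p2 = k * q2.
  by exists k; rewrite /lv /= scalerBr !scalerA.
have [q10|q1N] := eqVneq q1 0; last first.
  by exists (p1 / q1); rewrite ?mulfVK // mulrAC pq mulfK.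
have q2N : q2 != 0 by apply: contraNneq q0 => q20; rewrite q10 q20.
exists (p2 / q2); rewrite ?mulfVK //.
by apply: (mulIf q2N); rewrite pq q10 !mulr0 mul0r.
Qed.

Lemma par_reps (s : seq (K * K)) : exists t : seq (K * K),
  [/\ {subset t <= s}, pairwise (fun p q => ~~ par p q) t &
      forall p, p \in s -> exists2 q, q \in t & par p q].
Proof.
elim: s => [|p s [t [ts tp st]]]; first by exists [::].
have sub : {subset t <= p :: s} by move=> q /ts qs; rewrite inE qs orbT.
have [/hasP[q qt pq]|/hasPn pN] := boolP (has (par p) t).
  by exists t; split=> // r; rewrite inE => /predU1P[->|/st //]; exists q.
exists (p :: t); split=> [r|/=|r]; rewrite ?inE.
- by case/predU1P=> [->|/ts ->]; rewrite ?eqxx ?orbT.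
- by rewrite tp andbT; apply/allP.
case/predU1P=> [->|/st[q qt rq]]; first by exists p; rewrite ?mem_head ?par_refl.
by exists q; rewrite // inE qt orbT.
Qed.

End Coordinates.

(** * Trihomogeneous polynomials *)

Section Trihomogeneous.
Variable K : fieldType.
Local Notation R := {mpoly K[6]}.
Implicit Types (p q : K * K) (i j : 'I_3) (P : point K) (F f g : R).

Lemma trihomM d e F g : trihom d F -> trihom e g ->
  trihom (d.1.1 + e.1.1, d.1.2 + e.1.2, d.2 + e.2)%N (F * g).
Proof.
move=> Fd ge m /msuppM_le/allpairsP[[m1 m2] /= [/Fd <- /ge <- ->]].
rewrite /tdeg !mnmDE /=; congr (_, _, _); lia.
Qed.

Lemma trihom1 : trihom (0, 0, 0)%N (1 : R).
Proof. by move=> m; rewrite msupp1 inE => /eqP ->; rewrite /tdeg !mnm0E. Qed.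

Lemma trihomC c d F : trihom d F -> trihom d (c%:MP * F).
Proof. by move=> Fd m; rewrite mul_mpolyC => /msuppZ_le/Fd. Qed.

Definition udeg i a : nat * nat * nat :=
  (if i == i0 then a else 0, if i == i1 then a else 0, if i == i2 then a else 0)%N.

Lemma lin_trihom i p : trihom (udeg i 1) (lin (lv i p)).
Proof.
move=> m; rewrite /lv linearB /= !linZ !lin_delta => /msuppB_le; rewrite mem_cat.
have H (k : 'I_6) (c : K) : m \in msupp (c *: 'X_k) -> m = U_(k)%MM.
  by move/msuppZ_le; rewrite msuppX inE => /eqP.
by case/orP=> /H ->; rewrite /tdeg !mnmE -!val_eqE /= !inordK //;
  elim/ord3P: i.
Qed.

Lemma lprod_trihom (s : seq ('I_3 * (K * K))) :
  exists d, trihom d (\prod_(u <- s) lin (lv u.1 u.2)).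
Proof.
elim: s => [|u s [d sd]].
  by exists (0, 0, 0)%N; rewrite big_nil; apply: trihom1.
rewrite big_cons; eexists; exact: trihomM (@lin_trihom u.1 u.2) sd.
Qed.

Lemma tcomp_trihom d e F : trihom d F -> tcomp e F = if e == d then F else 0.
Proof.
move=> Fd; rewrite /tcomp; case: eqP => [->|ed].
  rewrite [RHS]mpolyE big_seq_cond [RHS]big_seq; apply: eq_bigl => m.
  by apply: andb_idr => /Fd ->.
rewrite big_seq_cond big1 // => m /andP[/Fd -> /eqP de]; by case: ed.
Qed.

Lemma I_ptsP (C : seq (point K)) d F : trihom d F ->
  (I_pts C F <-> forall P, P \in C -> F.@[pt_vec P] = 0).
Proof.
move=> Fd; split=> [H P PC|H e P PC].
  by have := H d P PC; rewrite (tcomp_trihom _ Fd) eqxx.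
by rewrite (tcomp_trihom _ Fd); case: ifP => _; [apply: H|rewrite meval0].
Qed.

Lemma udegP i a F m : trihom (udeg i a) F -> m \in msupp F ->
  mdeg m = a /\ forall k : 'I_6, (k %/ 2)%N != i -> m k = 0%N.
Proof.
move=> Fd /Fd; rewrite /tdeg /udeg => -[].
have E (k : 'I_6) : m k = m (inord k) by rewrite inord_val.
have -> : mdeg m = (\sum_(0 <= k < 6) m (inord k))%N.
  by rewrite mdegE big_mkord; apply: eq_bigr.
rewrite unlock /=.
move=> e0 e1 e2; split.
  by move: e0 e1 e2; elim/ord3P: i {Fd} => /=; lia.
move=> k; rewrite (E k); move: e0 e1 e2.
by case: k => -[|[|[|[|[|[|//]]]]]] Hk; elim/ord3P: i {Fd} => //=; lia.
Qed.

(** Killing the variables of the other two groups isolates one generator of the complete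
    intersection: the generators of the other two groups go to zero. *)
Definition only_group i : 6.-tuple R :=
  [tuple if (k %/ 2 == i)%N then 'X_k else 0 | k < 6].

Lemma only_group_id i a F : trihom (udeg i a) F -> F \mPo only_group i = F.
Proof.
move=> Fd; rewrite comp_mpolyE [RHS]mpolyE big_seq [RHS]big_seq.
apply: eq_bigr => m /(udegP Fd)[_ m0]; congr (_ *: _); rewrite [RHS]mpolyXE_id.
apply: eq_bigr => k _; rewrite tnth_mktuple; case: eqP => // /eqP/m0 ->.
by rewrite !expr0.
Qed.

Lemma only_group_neq i j a F : i != j -> trihom (udeg j a) F -> (0 < a)%N ->
  F \mPo only_group i = 0.
Proof.
move=> ij Fd a0; rewrite comp_mpolyE big_seq big1 // => m /(udegP Fd)[ma m0].
suff [k kj mk] : exists2 k : 'I_6, (k %/ 2 == j)%N & m k != 0%N.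
  rewrite (bigD1 k) //= tnth_mktuple (eqP kj) (_ : (j == i :> nat) = false); last first.
    by rewrite eq_sym; apply: negPf ij.
  by rewrite expr0n (negPf mk) mul0r scaler0.
case: (pickP [pred k | m k != 0%N]) => [k /= mk|m_0].
  by exists k => //; apply: contraNT mk => /m0 ->.
by move: a0; rewrite -ma mdegE big1 // => k _; move/negbFE/eqP: (m_0 k).
Qed.

(* If [q] is a linear form with value [1] at [P], then [F] is congruent to
   [F(P) q ^ a] modulo the linear form vanishing at the [i]-th coordinate of [P]. *)
Lemma gen_lform_of_root i a F P : P i != (0, 0) -> trihom (udeg i a) F ->
  F.@[pt_vec P] = 0 -> gen [:: lin (lv i (P i))] F.
Proof.
move=> Pi0 Fd F0; pose xe : R := 'X_(inord (2 * i)); pose xo : R := 'X_(inord (2 * i + 1)).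
have [q [Hq0 Hq1]] : exists q : R, gen [:: lin (lv i (P i))] (xe - (P i).1 *: q)
    /\ gen [:: lin (lv i (P i))] (xo - (P i).2 *: q).
  rewrite -lform_lin /lform /xvar /= addn0 -/xe -/xo.
  case: (P i) Pi0 => u v /= uv0.
  (* [q] is a variable of the group divided by the corresponding nonzero coordinate. *)
  have [u0|uN] := eqVneq u 0; last first.
    exists (u^-1 *: xe); rewrite !scalerA mulfV // scale1r subrr.
    split; first exact: ideal0 (gen_ideal _).
    apply/gen_cons; exists (- u^-1)%:MP; apply/gen_nil.
    rewrite mpolyCN mulNr opprK mul_mpolyC scalerBr !scalerA mulVf // scale1r.
    by rewrite [v * _]mulrC addrA subrK subrr.
  have vN : v != 0 by apply: contraNneq uv0 => v0; rewrite u0 v0.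
  exists (v^-1 *: xo); rewrite !scalerA mulfV // scale1r subrr u0 mul0r scale0r subr0.
  split; last exact: ideal0 (gen_ideal _).
  apply/gen_cons; exists (v^-1)%:MP; apply/gen_nil.
  by rewrite mul_mpolyC ?scale0r ?subr0 scalerA mulVf // scale1r subrr.
pose lq := [tuple if (k %/ 2 == i)%N then pt_vec P k *: q else 'X_k | k < 6].
have: gen [:: lin (lv i (P i))] (F - (F \mPo lq)).
  apply: ideal_subst (gen_ideal _) _ => k; rewrite tnth_mktuple.
  case: eqP => [ki|_]; last by rewrite subrr; apply: ideal0 (gen_ideal _).
  rewrite /pt_vec ki inord_val; have := divn_eq k 2; have := ltn_ord i.
  rewrite modn2 ki; case: ifP => kodd ilt kE.
    by rewrite (_ : k = inord (2 * i + 1)) //; apply: val_inj; rewrite /= inordK; lia.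
  by rewrite (_ : k = inord (2 * i)) //; apply: val_inj; rewrite /= inordK; lia.
(* Every monomial of [F] has degree [a] in group [i] alone, so substitution gives its value at [P]
   times [q ^+ a]. *)
suff -> : F \mPo lq = F.@[pt_vec P] *: q ^+ a by rewrite F0 scale0r subr0.
rewrite comp_mpolyE mevalE scaler_suml big_seq [RHS]big_seq.
apply: eq_bigr => m /(udegP Fd)[ma m0]; rewrite -scalerA; congr (_ *: _).
rewrite -ma mdegE expr_sum -scaler_prod; apply: eq_bigr => k _.
rewrite tnth_mktuple; case: eqP => [_|/eqP/m0 ->]; first by rewrite exprZn.
by rewrite !expr0 scale1r.
Qed.

End Trihomogeneous.

(** * Coordinates of a complete intersection of points *)

Section CompleteIntersectionCoordinates.
Variable K : fieldType.
Local Notation R := {mpoly K[6]}.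
Implicit Types (p q : K * K) (i j : 'I_3) (P : point K) (f g : R) (C : seq (point K)).

Lemma regseq_neq0 (Fs : seq R) k : regseq_mod (@zero_ideal K) Fs ->
  (k < size Fs)%N -> Fs`_k != 0.
Proof.
case=> Fs1 nzd kFs; apply/eqP => Fk0; apply: Fs1.
suff: gen (take k Fs) 1 by apply: gen_subset => x; apply: mem_take.
by apply: (nzd k kFs); rewrite Fk0 mulr0; apply: ideal0 (gen_ideal _).
Qed.

(** In degree zero the nonzero form would be a constant, so the sequence would generate the unit
    ideal. *)
Lemma regseq_udeg_gt0 (Fs : seq R) k i a : regseq_mod (@zero_ideal K) Fs ->
  (k < size Fs)%N -> trihom (udeg i a) Fs`_k -> (0 < a)%N.
Proof.
move=> reg kFs Fd; rewrite lt0n; apply/eqP => a0.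
have Fk0 := regseq_neq0 reg kFs; case: reg => Fs1 _; apply: Fs1.
have /msize1_polyC Fc : (msize Fs`_k <= 1)%N.
  rewrite leqNgt; apply/negP; rewrite -mlead_deg //.
  by have [-> _] := udegP Fd (mlead_supp Fk0); rewrite a0.
have c0 : Fs`_k@_0 != 0 by apply: contraNneq Fk0 => c0; rewrite Fc c0 mpolyC0.
have -> : (1 : R) = (Fs`_k@_0)^-1%:MP * Fs`_k by rewrite {2}Fc -mpolyCM mulVf.
exact: gen_mulmem (mem_nth _ _).
Qed.

Lemma mpoly_unitC (u h : R) : u * h = 1 -> exists c : K, h = c%:MP.
Proof.
move=> uh; have /norP[u0 h0] : ~~ ((u == 0) || (h == 0)).
  by rewrite -mulf_eq0 uh oner_eq0.
have e : msize (u * h) = (msize u + msize h).-1 by exact: msizeM.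
rewrite uh msize1 in e.
exists h@_0; apply: msize1_polyC.
by move: e u0 h0; rewrite -!msize_poly_eq0; lia.
Qed.

Lemma gen_vanish (s : seq R) (v : 'I_6 -> K) f :
  (forall x, x \in s -> x.@[v] = 0) -> gen s f -> f.@[v] = 0.
Proof.
apply: (@gen_sub _ (fun g => g.@[v] = 0)).
split=> [|g h g0 h0|g h h0]; first exact: meval0.
  by rewrite mevalD g0 h0 addr0.
by rewrite mevalM h0 mulr0.
Qed.

Lemma linprod_trihom i (s : seq (K * K)) :
  trihom (udeg i (size s)) (lprod (map (lv i) s)).
Proof.
rewrite /lprod big_map; elim: s => [|p s IHs].
  by rewrite big_nil /udeg !if_same; apply: trihom1.
rewrite big_cons; have := trihomM (@lin_trihom _ i p) IHs.
by congr (trihom _ _); elim/ord3P: i {IHs}.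
Qed.

(** [D i] represents the [i]-th coordinates of [C] up to proportionality. With [Q i] the product of
    its forms, [F i] and [Q i] divide each other, so they share their degree, and every point of the
    product grid is a zero of all [F i]. *)
Lemma exists_par_coords C (F : 'I_3 -> R) (d : 'I_3 -> nat) :
  (forall P, P \in C -> pt_ok P) ->
  (forall i, trihom (udeg i (d i)) (F i)) -> (forall i, 0 < d i)%N ->
  (forall i, F i != 0) -> ~ gen [:: F i0; F i1; F i2] 1 ->
  (forall f, I_pts C f <-> gen [:: F i0; F i1; F i2] f) ->
  exists D : 'I_3 -> seq (K * K),
    (forall i p, p \in D i -> p != (0, 0)) /\
    (forall i, pairwise (fun p q => ~~ par p q) (D i)) /\
    (forall i, D i != [::]) /\
    (forall P, P \in C -> forall i, exists2 p, p \in D i & par (P i) p) /\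
    (forall p : 'I_3 -> K * K, (forall i, p i \in D i) ->
       exists2 P, P \in C & forall i, par (P i) (p i)) /\
    (forall i, trihom (udeg i (d i)) (lprod (map (lv i) (D i)))).
Proof.
move=> HC Fd d0 F0 F1 IC.
have memF i : F i \in [:: F i0; F i1; F i2] by elim/ord3P: i; rewrite !inE eqxx ?orbT.
have [D HD] : exists D : 'I_3 -> seq (K * K), forall i,
    [/\ {subset D i <= [seq P i | P : point K <- C]},
        pairwise (fun p q => ~~ par p q) (D i) &
        forall p, p \in [seq P i | P : point K <- C] -> exists2 q, q \in D i & par p q].
  pose T i (t : seq (K * K)) := [/\ {subset t <= [seq P i | P : point K <- C]},
        pairwise (fun p q => ~~ par p q) t &
        forall p, p \in [seq P i | P : point K <- C] -> exists2 q, q \in t & par p q].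
  by apply: (@fin_all_exists 'I_3 (fun=> seq (K * K)) T) => i; apply: par_reps.
pose Q i : R := lprod (map (lv i) (D i)).
have Dsub i p : p \in D i -> exists2 P, P \in C & p = P i.
  by have [sub _ _] := HD i; move/sub/mapP.
have Dpar P i : P \in C -> exists2 p, p \in D i & par (P i) p.
  by have [_ _ cov] := HD i; move=> PC; apply/cov/map_f.
have Dnz i p : p \in D i -> p != (0, 0) by move=> /Dsub[P /HC/(_ i) ? ->].
have Dpw i : pairwise (fun p q => ~~ par p q) (D i) by have [] := HD i.
have FC i P : P \in C -> (F i).@[pt_vec P] = 0.
  by move: P; apply/(I_ptsP C (Fd i)); apply/IC/gen_mem.
have FQ i : gen [:: Q i] (F i).
  apply: gen_lprod => // [p D' sub pD'|p /Dsub[P PC ->]].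
    apply: (@nzd_lprods _ [:: map (lv i) D'] [::]) => -[|v [|? ?]];
      rewrite /choices /= ?andbF // andbT => /mapP[q qD' ->].
    (* Arbitrary nonproportional pairs fill the other two groups, making the two forms part of a
       full frame. *)
    pose p' k := if k == i then p else (1, 0); pose q' k := if k == i then q else (0, 1).
    have fr : free (frame p' q').
      apply: frame_free => k; rewrite /p' /q'; case: eqP => _; first exact: (allP pD').
      by rewrite /par /= !mulr1 !mul0r oner_eq0.
    have := free_nth (ns := [:: nat_of_ord i; (i + 3)%N]) fr; rewrite /= inE !andbT.
    by rewrite /p' /q'; elim/ord3P: i {FC p' q' sub pD' qD' fr} => /=; apply.
  exact: gen_lform_of_root (HC P PC i) (Fd i) (FC i P PC).
have QF i : exists h, Q i = h * F i.
  have : gen [:: F i0; F i1; F i2] (Q i).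
    apply/IC; apply/(I_ptsP C (@linprod_trihom i (D i))) => P PC.
    have [p pD pP] := Dpar P i PC; apply: lprod_vanish pD _.
    by apply/eqP; rewrite meval_lform_eq0 par_sym.
  have Qi : Q i \mPo only_group K i = Q i by apply: only_group_id (@linprod_trihom i (D i)).
  move=> QiF; rewrite -Qi; move: QiF.
  apply: (@gen_sub _ (fun f => exists h, f \mPo only_group K i = h * F i)).
    split=> [|f g [h fE] [h' gE]|r f [h fE]].
    - by exists 0; rewrite linear0 mul0r.
    - by exists (h + h'); rewrite linearD /= fE gE mulrDl.
    - by exists ((r \mPo only_group K i) * h); rewrite rmorphM /= fE mulrA.
  have Fi j : exists h, F j \mPo only_group K i = h * F i.
    have [->|ji] := eqVneq j i; first by exists 1; rewrite (only_group_id (Fd i)) mul1r.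
    by exists 0; rewrite mul0r (only_group_neq _ (Fd j)) // eq_sym.
  by move=> x; rewrite !inE => /or3P[]/eqP ->.
have FuQ i : exists u, F i = u * Q i.
  have /gen_cons[u /gen_nil/eqP] := FQ i; rewrite subr_eq0 => /eqP ?; by exists u.
have Qd i : trihom (udeg i (d i)) (Q i).
  have [h hE] := QF i; have [u uE] := FuQ i.
  have /mpoly_unitC[c cE] : u * h = 1.
    by apply: (mulIf (F0 i)); rewrite -mulrA -hE -uE mul1r.
  by rewrite hE cE; apply: trihomC.
(* For empty [C] the vanishing ideal would contain [1]. *)
have C0 : exists P, P \in C.
  case: C IC {HC HD Dsub Dpar FC} => [|P C] IC; last by exists P; rewrite mem_head.
  by case: F1; apply/IC => e P.
exists D; split=> //; split=> //; split; [|split; [|split=> //]].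
- by move=> i; have [P /(Dpar P i)[p]] := C0; case: (D i).
- by move=> P PC i; apply: Dpar.
move=> p pD; have [/hasP[P PC /forallP]|/hasPn noP] :=
  boolP (has (fun P : point K => [forall i, par (P i) (p i)]) C); first by exists P.
(* If the grid point [p] were missing, each [P] in [C] would differ from it in some coordinate
   [k P]. The product of the forms of [P] in these coordinates vanishes on [C], hence at [p],
   although no factor does. *)
pose k (P : point K) := odflt i0 [pick i | ~~ par (P i) (p i)].
have kP P : P \in C -> ~~ par (P (k P)) (p (k P)).
  move/noP; rewrite negb_forall /k => /existsP[i iP].
  by case: pickP => [//|/(_ i)]; rewrite iP.
have [e Ge] := lprod_trihom [seq (k P, P (k P)) | P <- C].
pose pt : point K := [ffun i => p i].
have : \prod_(u <- [seq (k P, P (k P)) | P <- C]) (lin (lv u.1 u.2)).@[pt_vec pt] = 0.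
  rewrite -rmorph_prod /=; apply: (@gen_vanish [:: F i0; F i1; F i2]).
    have Fp i : (F i).@[pt_vec pt] = 0.
      have [u ->] := FuQ i; rewrite mevalM (lprod_vanish (pD i)) ?mulr0 //.
      by apply/eqP; rewrite meval_lform_eq0 ffunE par_refl.
    by move=> x; rewrite !inE => /or3P[]/eqP ->.
  apply/IC/(I_ptsP C Ge) => P PC; rewrite big_map (big_rem P) //= mevalM.
  by rewrite (eqP (_ : _.@[_] == 0)) ?mul0r // meval_lform_eq0 par_refl.
move/eqP; rewrite big_map prodf_seq_eq0 => /hasP[P PC /=].
by rewrite meval_lform_eq0 ffunE (negPf (kP P PC)).
Qed.

End CompleteIntersectionCoordinates.

(** * The ideal of the grid *)

(** In characteristic zero the naturals give more values than there are slopes [p.2 / p.1], so some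
    [(1, t)] avoids them all. *)
Lemma exists_nonpar (K : fieldType) (s : seq (K * K)) : [pchar K] =i pred0 ->
  (forall p, p \in s -> p != (0, 0)) -> exists q, all (fun p => ~~ par p q) s.
Proof.
move=> /pcharf0P char0 s0; pose bad := [seq p.2 / p.1 | p <- s].
pose nats : seq K := [seq n%:R | n <- iota 0 (size bad).+1].
have nats_uniq : uniq nats.
  rewrite map_inj_uniq ?iota_uniq // => m n /eqP.
  wlog mn : m n / (m <= n)%N => [H|].
    by case/orP: (leq_total m n) => [/H //|/H nm]; rewrite eq_sym => /nm.
  by rewrite eq_sym -subr_eq0 -natrB // char0 subn_eq0 => nm; apply/eqP; rewrite eqn_leq mn.
have [/hasP[t _ tN]|/hasPn sub] := boolP (has (fun t => t \notin bad) nats); last first.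
  have /(uniq_leq_size nats_uniq) : {subset nats <= bad} by move=> t /sub/negPn.
  by rewrite size_map size_iota ltnn.
exists (1, t); apply/allP => p ps; rewrite /par /= mulr1; apply: contra tN => /eqP pt.
apply/mapP; exists p => //; have p1 : p.1 != 0.
  apply: contraNneq (s0 p ps) => p10; move: pt; rewrite p10 mul0r.
  by case: p p10 {ps} => /= u v -> <-.
by rewrite -pt mulrAC mulfV // mul1r.
Qed.

Section Grid.
Variable K : fieldType.
Local Notation R := {mpoly K[6]}.
Local Notation V := 'rV[K]_6.
Variables (C : seq (point K)) (D : 'I_3 -> seq (K * K)) (A : 'I_3 -> K * K).
Hypothesis C_ok : forall P, P \in C -> pt_ok P.
Hypothesis D_neq0 : forall i p, p \in D i -> p != (0, 0).
Hypothesis D_nonpar : forall i, pairwise (fun p q => ~~ par p q) (D i).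
Hypothesis D_ne : forall i, D i != [::].
Hypothesis C_D : forall P, P \in C -> forall i, exists2 p, p \in D i & par (P i) p.
Hypothesis D_C : forall p : 'I_3 -> K * K, (forall i, p i \in D i) ->
  exists2 P, P \in C & forall i, par (P i) (p i).
Hypothesis A_nonpar : forall i, all (fun p => ~~ par p (A i)) (D i).

(* Indices 0, 1, 2: the three factors of the complete intersection; 3, 4, 5: one
   auxiliary linear form per group of variables. *)
Definition axis_forms (k : nat) : seq V := nth [::]
  [:: map (lv i0) (D i0); map (lv i1) (D i1); map (lv i2) (D i2);
      [:: lv i0 (A i0)]; [:: lv i1 (A i1)]; [:: lv i2 (A i2)]] k.

Local Notation T := axis_forms.

Definition axis_prod (k : nat) : R := lprod (T k).
Local Notation Q := axis_prod.

Lemma D_mem i : exists p, p \in D i.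
Proof. by move: (D_ne i); case: (D i) => // p s _; exists p; rewrite mem_head. Qed.

Lemma T_ord (i : 'I_3) : T i = map (lv i) (D i).
Proof. by elim/ord3P: i. Qed.

(** Groups from which no factor is chosen are completed by any element of [D i], so a choice always
    extends to a full frame. *)
Lemma choices_frame ns vs : uniq ns -> all (fun k => (k < 6)%N) ns ->
  choices (map T ns) vs ->
  exists2 p : 'I_3 -> K * K, (forall i, p i \in D i) &
    vs = [seq nth 0 (frame p A) k | k <- ns].
Proof.
move=> ns_uniq ns6; rewrite /choices all2E size_map => /andP[/eqP vs_size /allP vsT].
have vsT' k : k \in ns -> nth 0 vs (index k ns) \in T k.
  move=> kns; have kn : (index k ns < size ns)%N by rewrite index_mem.
  have /vsT : (nth 0 vs (index k ns), T k) \in zip vs (map T ns).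
    rewrite -[X in (_, T X)](nth_index 0%N kns) -(nth_map 0%N [::]) //.
    by rewrite -nth_zip ?size_map // mem_nth // size_zip size_map vs_size minnn.
  by [].
have [p Hp] : exists p : 'I_3 -> K * K, forall i : 'I_3,
    p i \in D i /\ ((i : nat) \in ns -> nth 0 vs (index (i : nat) ns) = lv i (p i)).
  apply: (@fin_all_exists 'I_3 (fun=> (K * K)%type) (fun i (x : K * K) => x \in D i /\
    ((i : nat) \in ns -> nth 0 vs (index (i : nat) ns) = lv i x))) => i.
  have [ins|iN] := boolP ((i : nat) \in ns); last by have [x] := D_mem i; exists x.
  by have := vsT' _ ins; rewrite T_ord => /mapP[x xD xE]; exists x.
exists p => [i|]; first by have [] := Hp i.
apply: (@eq_from_nth _ 0) => [|n]; first by rewrite size_map.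
rewrite vs_size => nns; rewrite (nth_map 0%N) //.
have kns := mem_nth 0%N nns; move: (allP ns6 _ kns) (vsT' _ kns).
have -> : nth 0 vs n = nth 0 vs (index (nth 0%N ns n) ns) by rewrite index_uniq.
have H i := (Hp i).2.
move: (nth 0%N ns n) kns => k kns.
case: k kns => [|[|[|[|[|[|//]]]]]] kns _ /=.
- by rewrite (H i0 kns).
- by rewrite (H i1 kns).
- by rewrite (H i2 kns).
all: by rewrite inE => /eqP.
Qed.

Lemma nzd_Q k ns : uniq (k :: ns) -> all (fun k => (k < 6)%N) (k :: ns) ->
  nzd_mod (gen (map Q ns)) (Q k).
Proof.
move=> k_uniq k6; rewrite /(Q k) /lprod -(big_map (@lin K) xpredT id).
apply: nzd_prod => _ /mapP[v vT ->].
rewrite -[map Q ns]cats0 -[[::]]/(map (@lin K) [::]) map_comp.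
apply: nzd_lprods => vs c; rewrite cats0.
have /choices_frame[//|//|p pD ->] : choices (map T (k :: ns)) (v :: vs).
  by rewrite /choices /= vT.
apply: free_nth k_uniq _ => //; apply: frame_free => i.
exact: (allP (A_nonpar i)).
Qed.

Lemma frame_D_free (p : 'I_3 -> K * K) : (forall i, p i \in D i) -> free (frame p A).
Proof. by move=> pD; apply: frame_free => i; apply: (allP (A_nonpar i)). Qed.

Definition grid_gens : seq R := [:: Q 0 * Q 1; Q 0 * Q 2; Q 1 * Q 2].

(** Any [p] in [D i] and [q] in [D j] are coordinates of some point of [C], so [f] lies in the ideal
    of their two forms; intersecting first over [p], then over [q], builds up the two products. *)
Lemma I_grid_pair f (i j : 'I_3) : I_grid C f -> i != j -> gen [:: Q i; Q j] f.
Proof.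
move=> If ij; have fij p q : p \in D i -> q \in D j -> gen [:: lin (lv i p); lin (lv j q)] f.
  (* The third coordinate is arbitrary; the default of [head] is never reached, as [D k] is
     nonempty. *)
  move=> pD qD; pose r k := if k == i then p else if k == j then q else head p (D k).
  have [k|P PC Pr] := D_C (p := r).
    rewrite /r; case: eqP => [->//|_]; case: eqP => [->//|_].
    by case: (D k) (D_ne k) => // x s _; rewrite mem_head.
  have Pscale k x s : r k = x -> x \in D k -> lin (lv k x) \in s -> gen s (lform P k).
    move=> rk xD xs; have Px : par (P k) x by rewrite -rk.
    have [c lvc] := par_scale k (C_ok PC k) (D_neq0 xD) Px.
    by rewrite lform_lin lvc linZ -mul_mpolyC; apply: gen_mulmem.
  apply: gen_sub_gen (If P PC i j ij) => x; rewrite !inE => /orP[]/eqP->.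
    by apply: (Pscale i p); rewrite /r ?eqxx // mem_head.
  by apply: (Pscale j q); rewrite /r ?eqxx 1?eq_sym ?(negPf ij) // !inE eqxx orbT.
have Tk (k : 'I_3) : Q k = lprod (map (lv k) (D k)) by rewrite /Q T_ord.
have nonpar1 k l p q r : k != l -> ~~ par p q -> r \in D l -> free [:: lv k p; lv k q; lv l r].
  by move=> kl pq /D_neq0; apply: free_lv3.
have fj q : q \in D j -> gen [:: Q i; lin (lv j q)] f.
  move=> qD; rewrite Tk; apply: gen_lprod => // [p D' _ pD'|p pD]; last exact: fij.
  apply: (@nzd_lprods _ [:: map (lv i) D'] [:: lv j q]) => -[|v [|? ?]];
    rewrite /choices /= ?andbF // andbT => /mapP[p' p'D ->].
  by apply: nonpar1 => //; apply: (allP pD').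
suff : gen [:: Q j; Q i] f by apply: gen_subset => x; rewrite !inE orbC.
rewrite Tk; apply: gen_lprod => // [p D' _ pD'|p /fj]; last first.
  by apply: gen_subset => x; rewrite !inE orbC.
rewrite Tk; apply: (@nzd_lprods _ [:: map (lv j) D'; map (lv i) (D i)] [::]).
case=> [|v [|w [|? ?]]]; rewrite /choices /= ?andbF // andbT.
move=> /andP[/mapP[p' p'D ->] /mapP[r rD ->]].
by apply: nonpar1 => //; [rewrite eq_sym|apply: (allP pD')].
Qed.

Lemma I_gridE f : I_grid C f <-> gen grid_gens f.
Proof.
split=> [If|].
  apply: gen_pairwise_products.
  - exact: (@nzd_Q 1 [:: 0; 2]).
  - exact: (@nzd_Q 0 [:: 1; 2]).
  - exact: (@I_grid_pair f i0 i1).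
  - exact: (@I_grid_pair f i0 i2).
  - exact: (@I_grid_pair f i1 i2).
move=> Gf P PC i j ij.
have Qk (k : 'I_3) s r : lform P k \in s -> gen s (r * Q k).
  move=> ks; apply: idealM (gen_ideal _) _; rewrite /Q T_ord.
  have [p pD Pp] := C_D PC k.
  rewrite par_sym in Pp; have [c lvc] := par_scale k (D_neq0 pD) (C_ok PC k) Pp.
  apply: gen_sub_gen (_ : gen [:: lin (lv k p)] _).
    move=> x; rewrite inE => /eqP ->.
    by rewrite lvc linZ -lform_lin -mul_mpolyC; apply: gen_mulmem.
  exact: gen_lprod_mem pD (mem_head _ _).
apply: gen_sub_gen Gf => x.
(* Two distinct indices out of three meet every pair, so each product contains [q i] or [q j]. *)
have key (l q : 'I_3 -> R) : (forall k s r, l k \in s -> gen s (r * q k)) ->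
    x \in [:: q i0 * q i1; q i0 * q i2; q i1 * q i2] -> gen [:: l i; l j] x.
  move=> lq; have lqC k s r : l k \in s -> gen s (q k * r) by rewrite mulrC; apply: lq.
  rewrite !inE => /or3P[]/eqP ->; move: ij; elim/ord3P: i; elim/ord3P: j => // _;
    first [apply: lq; rewrite !inE eqxx ?orbT; done | apply: lqC; rewrite !inE eqxx ?orbT; done].
exact: (key (lform P) (fun k => Q k) Qk).
Qed.

(** * Depth and dimension of the quotient by the grid ideal *)

Lemma lin_irrel v : in_irrel (@lin K v).
Proof.
rewrite /in_irrel /lin linear_sum big1 //= => k _.
by rewrite mcoeffZ mcoeffX mnm1_eq0 mulr0.
Qed.

Lemma gen_irrel (s : seq R) f : (forall x, x \in s -> in_irrel x) -> gen s f -> in_irrel f.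
Proof.
apply: gen_sub; split=> [|g h|r g]; rewrite /in_irrel ?mcoeff0 //.
  by rewrite mcoeffD => -> ->; rewrite addr0.
by rewrite rmorphM /= => ->; rewrite mulr0.
Qed.

Lemma Q_irrel k : (k < 6)%N -> in_irrel (Q k).
Proof.
move=> k6; have : exists v, v \in T k.
  have mem i : exists v, v \in map (lv i) (D i).
    by have [p pD] := D_mem i; exists (lv i p); apply: map_f.
  case: k k6 => [|[|[|[|[|[|//]]]]]] _; try exact: mem;
    by eexists; apply: mem_head.
case=> v vT; apply: (@gen_irrel [:: lin v]) => [x|].
  by rewrite inE => /eqP ->; apply: lin_irrel.
by rewrite /Q /lprod (big_rem v) //= mulrC; apply/gen_mulmem/mem_head.
Qed.

Lemma Q_neq0 k : (k < 6)%N -> Q k != 0.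
Proof.
move=> k6; apply/eqP => Q0; have /= := @nzd_Q k [::] isT; rewrite k6 Q0 => /(_ isT 1).
rewrite mulr0 => /(_ (ideal0 (gen_ideal _)))/gen_nil/eqP; rewrite oner_eq0 //.
Qed.

Lemma grid_regseq :
  regseq_mod (I_grid C) [:: Q 3; Q 4; Q 5; Q 0 + Q 1 + Q 2].
Proof.
have memI s : s ++ grid_gens =i [:: Q 0 * Q 1, Q 0 * Q 2, Q 1 * Q 2 & s].
  by move=> x; rewrite mem_cat orbC !inE -!orbA.
have spanE s f := span_with_gen s f I_gridE.
have irrelM (f g : R) : in_irrel g -> in_irrel (f * g).
  by rewrite /in_irrel rmorphM /= => ->; rewrite mulr0.
split.
  move/spanE/gen_irrel => H; have : in_irrel (1 : R).
    apply: H => x; rewrite mem_cat !inE -!orbA.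
    have QD : in_irrel (Q 0 + Q 1 + Q 2).
      by rewrite /in_irrel !mcoeffD !Q_irrel // !addr0.
    by do 6?[case/predU1P=> [->|]]; first [move/eqP=> -> | idtac];
      first [exact: QD | exact: Q_irrel | apply: irrelM; exact: Q_irrel].
  by rewrite /in_irrel mcoeff1 eqxx => /eqP; rewrite oner_eq0.
have span_nzd s g : nzd_mod (gen [:: Q 0 * Q 1, Q 0 * Q 2, Q 1 * Q 2 & s]) g ->
    nzd_mod (span_with (I_grid C) s) g.
  move=> ng; apply: nzd_equiv (fun f => iff_sym (spanE s f)) _.
  by apply: nzd_gen_eq ng => x; rewrite memI.
(* Five conditions for each of the four elements: two identify the ideal as an intersection, three
   cancel the element in its components. *)
case=> [|[|[|[|//]]]] _ /=; apply: span_nzd; apply: nzd_pairwise_products.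
- exact: (@nzd_Q 1 [:: 0; 2]).
- exact: (@nzd_Q 0 [:: 1; 2]).
- exact: (@nzd_Q 3 [:: 0; 1]).
- exact: (@nzd_Q 3 [:: 0; 2]).
- exact: (@nzd_Q 3 [:: 1; 2]).
- exact: (@nzd_Q 1 [:: 0; 2; 3]).
- exact: (@nzd_Q 0 [:: 1; 2; 3]).
- exact: (@nzd_Q 4 [:: 0; 1; 3]).
- exact: (@nzd_Q 4 [:: 0; 2; 3]).
- exact: (@nzd_Q 4 [:: 1; 2; 3]).
- exact: (@nzd_Q 1 [:: 0; 2; 3; 4]).
- exact: (@nzd_Q 0 [:: 1; 2; 3; 4]).
- exact: (@nzd_Q 5 [:: 0; 1; 3; 4]).
- exact: (@nzd_Q 5 [:: 0; 2; 3; 4]).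
- exact: (@nzd_Q 5 [:: 1; 2; 3; 4]).
- exact: (@nzd_Q 1 [:: 0; 2; 3; 4; 5]).
- exact: (@nzd_Q 0 [:: 1; 2; 3; 4; 5]).
(* Modulo two of [Q 0], [Q 1], [Q 2] the sum is congruent to the third. *)
- apply: nzd_congr (gen_ideal _) _ (@nzd_Q 2 [:: 0; 1; 3; 4; 5] isT isT).
  rewrite addrK; apply: idealD (gen_ideal _) _ _; apply: gen_mem; rewrite !inE eqxx ?orbT //.
- apply: nzd_congr (gen_ideal _) _ (@nzd_Q 1 [:: 0; 2; 3; 4; 5] isT isT).
  rewrite addrAC addrK; apply: idealD (gen_ideal _) _ _; apply: gen_mem; rewrite !inE eqxx ?orbT //.
- apply: nzd_congr (gen_ideal _) _ (@nzd_Q 0 [:: 1; 2; 3; 4; 5] isT isT).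
  rewrite (_ : _ - _ = Q 1 + Q 2); last by ring.
  apply: idealD (gen_ideal _) _ _; apply: gen_mem; rewrite !inE eqxx ?orbT //.
Qed.

(** The chain is generated by the first two up to all six forms of a frame. The first two are
    factors of [Q 0] and [Q 1], and every generator of the grid ideal involves one of these
    products. *)
Lemma grid_chain4 : prime_chain (I_grid C) 4.
Proof.
have [p pD] : exists p : 'I_3 -> K * K, forall i, p i \in D i.
  exact: (@fin_all_exists 'I_3 (fun=> (K * K)%type) (fun i x => x \in D i) D_mem).
pose vs := frame p A; have vs_free : free vs := frame_D_free pD.
exists (fun k => gen (map (@lin K) (take k.+2 vs))); split=> k kn.
  split=> [|f /I_gridE]; first exact: gen_lin_prime.
  have sub i : (i < 2)%N -> lin (nth 0 vs i) \in map (@lin K) (take k.+2 vs).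
    move=> i2; apply: map_f; rewrite -(@nth_take k.+2) ?(leq_trans i2) //.
    by apply: mem_nth; rewrite size_take_min /=; lia.
  have Q0m : gen (map (@lin K) (take k.+2 vs)) (Q 0).
    exact: gen_lprod_mem (pD i0) (sub 0%N isT).
  have Q1m : gen (map (@lin K) (take k.+2 vs)) (Q 1).
    exact: gen_lprod_mem (pD i1) (sub 1%N isT).
  have id := gen_ideal (map (@lin K) (take k.+2 vs)).
  apply: gen_sub => // x; rewrite !inE => /or3P[]/eqP ->;
    first [by apply: idealM | by rewrite mulrC; apply: idealM].
have takeS : take k.+3 vs = rcons (take k.+2 vs) (nth 0 vs k.+2).
  by rewrite -take_nth //=; lia.
split=> [f|].
  by apply: gen_subset => x; rewrite takeS map_rcons mem_rcons inE orbC => ->.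
exists (lin (nth 0 vs k.+2)); split.
  by apply: gen_mem; rewrite takeS map_rcons mem_rcons mem_head.
move/gen_lin_memE; apply/negP.
have: free (nth 0 vs k.+2 :: take k.+2 vs).
  rewrite (perm_free (Y := take k.+3 vs)); last by rewrite takeS perm_sym perm_rcons.
  by move: vs_free; rewrite -{1}(cat_take_drop k.+3 vs) => /catl_free.
by rewrite free_cons => /andP[].
Qed.

Lemma no_grid_chain5 : ~ prime_chain (I_grid C) 5.
Proof.
case=> P [Pprime chain]; have [[iP P1 Pmul] IP] := Pprime 0%N isT.
have QQ k l : Q k * Q l \in grid_gens -> P 0%N (Q k) \/ P 0%N (Q l).
  by move=> kl; apply/Pmul/IP/I_gridE/gen_mem.
(* A prime that meets each of the three pairs contains at least two of the [Q i]. *)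
have [i [j [ij [Pi Pj]]]] : exists i j : 'I_3, i != j /\ (P 0%N (Q i) /\ P 0%N (Q j)).
  have [] := QQ 0%N 1%N; rewrite ?mem_head // => P0.
    have [] := QQ 1%N 2%N; rewrite ?inE ?eqxx ?orbT // => P2; first by exists i0, i1.
    by exists i0, i2.
  have [] := QQ 0%N 2%N; rewrite ?inE ?eqxx ?orbT // => P2; first by exists i0, i1.
  by exists i1, i2.
have factor k : P 0%N (Q k) -> exists2 v, v \in T k & P 0%N (lin v).
  rewrite /Q /lprod; elim: (T k) => [|v t IHt]; rewrite ?big_nil ?big_cons // => /Pmul[Pv|/IHt].
    by exists v; rewrite ?mem_head.
  by case=> w wt Pw; exists w; rewrite // inE wt orbT.
have [v + Pl] := factor i Pi; have [w + Pm] := factor j Pj.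
rewrite !T_ord => /mapP[q qD wE] /mapP[p pD vE]; rewrite {}wE in Pm; rewrite {}vE in Pl.
have fr : free [:: lv j q; lv i p].
  have := free_lv3 ij (allP (A_nonpar i) _ pD) (D_neq0 qD).
  by move/(@free_nth _ _ [:: 2; 0]); apply.
apply: (@no_prime_chain7 K).
(* The given chain is shifted by two: zero and [(lin (lv i p))] go below [P 0], strictly since [P 0]
   also contains the independent form [lin (lv j q)]. *)
exists (fun k => if k is k'.+1 then
  (if k' is k''.+1 then P k'' else gen (map (@lin K) [:: lv i p])) else @zero_ideal K).
split=> [[|[|k]] kn|[|[|k]] kn].
- split=> //; split=> [||f g /eqP]; rewrite /zero_ideal.
  + split=> [//|f g -> ->|r f ->]; by rewrite ?addr0 ?mulr0.
  + by apply/eqP; rewrite oner_eq0.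
  + by rewrite mulf_eq0 => /orP[]/eqP; [left|right].
- split=> [|f ->]; first exact: gen_lin_prime.
  exact: ideal0 (gen_ideal _).
- by have [pr _] := Pprime k kn; split=> // f ->; case: pr => iPk _ _; apply: ideal0.
- split=> [f ->|]; first exact: ideal0 (gen_ideal _).
  exists (lin (lv i p)); split; first by apply: gen_mem; rewrite mem_head.
  by move/lin_eq0/eqP; apply/negP/(free_not0 fr); rewrite !inE eqxx orbT.
- split=> [f|]; first by apply: gen_sub => // x; rewrite inE => /eqP ->.
  exists (lin (lv j q)); split=> //.
  by move/gen_lin_memE; apply/negP; move: fr; rewrite free_cons => /andP[].
- exact: chain.
Qed.

Lemma grid_CM : CM_quot (I_grid C).
Proof.
exists 4; split; first by split; [apply: grid_chain4|apply: no_grid_chain5].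
exists [:: Q 3; Q 4; Q 5; Q 0 + Q 1 + Q 2]; split=> //.
split; last exact: grid_regseq.
move=> g; rewrite !inE => /or4P[]/eqP ->; try exact: Q_irrel.
by rewrite /in_irrel !mcoeffD !Q_irrel // !addr0.
Qed.

(** * The Hilbert-Burch resolution *)

Lemma grid_has_resolution a b c :
  trihom (a, 0, 0)%N (Q 0) -> trihom (0, b, 0)%N (Q 1) -> trihom (0, 0, c)%N (Q 2) ->
  grid_resolution (I_grid C) a b c.
Proof.
move=> Q0d Q1d Q2d.
have Nd d (F : R) : trihom d F -> trihom d (- F).
  by move=> Fd m; rewrite (perm_mem (msuppN _)) => /Fd.
have d0 d : trihom d (0 : R) by move=> m; rewrite msupp0.
have eqd d e (F : R) : d = e -> trihom d F -> trihom e F by move=> ->.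
(* The syzygy columns [(Q 2, - Q 1, 0)] and [(Q 2, 0, - Q 0)] compare the first generator with each
   of the others. *)
exists (Q 0 * Q 1), (Q 0 * Q 2), (Q 1 * Q 2), (Q 2), (Q 2), (- Q 1), 0, 0, (- Q 0).
split.
  do !split=> //; try exact: Nd.
  - by apply: eqd (trihomM Q0d Q1d); rewrite /= ?addn0.
  - by apply: eqd (trihomM Q0d Q2d); rewrite /= ?addn0.
  - by apply: eqd (trihomM Q1d Q2d); rewrite /= ?addn0.
split=> [f|].
  rewrite I_gridE; split.
    case/gen_cons=> h1 /gen_cons[h2 /gen_cons[h3 /gen_nil e]].
    by exists h1, h2, h3; apply/eqP; rewrite -subr_eq0 !opprD !addrA e.
  case=> h1 [h2 [h3 ->]]; have id := gen_ideal grid_gens.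
  do !apply: idealD => //; by apply: gen_mulmem; rewrite !inE eqxx ?orbT.
split; first by split; ring.
split=> [h1 h2 h3 e|].
  (* Modulo [Q 0] the relation reads [h3 * (Q 1 * Q 2) = 0], so [Q 0] divides [h3]; likewise [Q 1]
     divides [h2]. *)
  have /gen_cons[u /gen_nil/eqP] : gen [:: Q 0] h3.
    apply: (@nzd_Q 1 [:: 0]) => //; apply: (@nzd_Q 2 [:: 0]) => //.
    rewrite (_ : _ * _ = - (h1 * Q 1 + h2 * Q 2) * Q 0 + (h1 * (Q 0 * Q 1)
      + h2 * (Q 0 * Q 2) + h3 * (Q 1 * Q 2))); last by ring.
    by rewrite e addr0; apply/gen_mulmem/mem_head.
  rewrite subr_eq0 => /eqP h3E.
  have /gen_cons[v /gen_nil/eqP] : gen [:: Q 1] h2.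
    apply: (@nzd_Q 0 [:: 1]) => //; apply: (@nzd_Q 2 [:: 1]) => //.
    rewrite (_ : _ * _ = - (h1 * Q 0 + h3 * Q 2) * Q 1 + (h1 * (Q 0 * Q 1)
      + h2 * (Q 0 * Q 2) + h3 * (Q 1 * Q 2))); last by ring.
    by rewrite e addr0; apply/gen_mulmem/mem_head.
  rewrite subr_eq0 => /eqP h2E; exists (- v), (- u); rewrite h3E h2E.
  split; [|by ring|by ring].
  (* The formula for [h1] is the original relation after cancelling [Q 0 * Q 1]. *)
  apply: (mulIf (mulf_neq0 (@Q_neq0 0 isT) (@Q_neq0 1 isT))).
  apply/eqP; rewrite -subr_eq0 -e h2E h3E; apply/eqP; ring.
split=> [s t _ /eqP|].
  rewrite mul0r addr0 mulNr oppr_eq0 mulf_eq0 (negPf (@Q_neq0 1 isT)) /= => /eqP -> /eqP.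
  by rewrite mul0r add0r mulNr oppr_eq0 mulf_eq0 (negPf (@Q_neq0 0 isT)) /= => /eqP ->.
have QN k : (k < 6)%N -> in_irrel (- Q k) by move=> /Q_irrel; rewrite /in_irrel mcoeffN => ->; rewrite oppr0.
by do !split; try exact: Q_irrel; try exact: QN; rewrite /in_irrel mcoeff0.
Qed.

End Grid.

Theorem theorem5p6 (K : closedFieldType) (Kchar0 : [pchar K]%R =i pred0)
  (a b c : nat) (C : seq (point K))
  (HC : forall P, P \in C -> pt_ok P)
  (Hci : is_CI_type C a b c) :
  CM_quot (I_grid C) /\ grid_resolution (I_grid C) a b c.
Proof.
case: Hci => [F0 [F1 [F2 [F0d F1d F2d reg IC]]]].
pose F (i : 'I_3) := nth 0 [:: F0; F1; F2] i.
pose d (i : 'I_3) := nth 0%N [:: a; b; c] i.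
have Fd i : trihom (udeg i (d i)) (F i) by elim/ord3P: i.
have d_gt0 i : (0 < d i)%N by apply: (regseq_udeg_gt0 reg (ltn_ord i) (Fd i)).
have F_neq0 i : F i != 0 by apply: (regseq_neq0 reg (ltn_ord i)).
have [D [D_neq0 [D_nonpar [D_ne [C_D [D_C Qd]]]]]] :=
  exists_par_coords HC Fd d_gt0 F_neq0 reg.1 IC.
have [A A_nonpar] : exists A : 'I_3 -> K * K, forall i, all (fun p => ~~ par p (A i)) (D i).
  apply: (@fin_all_exists 'I_3 (fun=> (K * K)%type)
    (fun i x => all (fun p => ~~ par p x) (D i))) => i.
  by apply: exists_nonpar => //; apply: D_neq0.
split; first exact: (grid_CM HC D_neq0 D_nonpar D_ne C_D D_C A_nonpar).
apply: (grid_has_resolution HC D_neq0 D_nonpar D_ne C_D D_C A_nonpar).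
- exact: (Qd i0).
- exact: (Qd i1).
- exact: (Qd i2).
Qed.
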